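(* Let $(M^6,\psi^\pm,\omega,g,J)$ be a connected 6-dimensional strict nearly K\''ahler manifold, let $d\ge 3$, and let $\zeta_1,\dots,\zeta_d$ be linearly independent (over $\mathbb{R}$), mutually commuting Killing vector fields on $M$ with $L_{\zeta_i}J=0$ for $1\le i\le d$. Then for every mutually distinct $1\le i,j,k\le d$, the $6$ vector fields $\zeta_i,\zeta_j,\zeta_k,J\zeta_i,J\zeta_j,J\zeta_k$ are linearly independent (at every point) on a dense open subset $M_0$ of $M$.
   Context: An $\mathrm{SU}(3)$-structure on an oriented 6-manifold $M$ is a triple $(g,J,\psi)$ where $g$ is a Riemannian metric, $J$ is a compatible almost complex structure (so $\omega:=g(J\cdot,\cdot)$ is a 2-form) and $\psi=\psi^++i\psi^-$ is a $(3,0)$ complex volume form with $\psi\wedge\bar\psi=-8i\,\mathrm{vol}_g$, where $\mathrm{vol}_g=\frac16\omega^3$. A strict nearly K\''ahler structure is an $\mathrm{SU}(3)$-structure satisfying $d\omega=3\psi^+$ and $d\psi^-=-2\,\omega\wedge\omega$. For the vector fields considered, the conditions ''Killing and $L_\zeta J=0$'' are equivalent to $L_\zeta\psi^\pm=0$ and $L_\zeta\omega=0$. *)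

(* Defs.v *)
From HB Require Import structures.
From mathcomp Require Import all_boot all_order all_algebra all_fingroup.
From mathcomp Require Import all_classical all_reals all_analysis.
From mathcomp Require Import complex.

Set Implicit Arguments.
Unset Strict Implicit.
Unset Printing Implicit Defensive.

Import Order.TTheory GRing.Theory Num.Theory numFieldNormedType.Exports.

Local Open Scope classical_set_scope.
Local Open Scope ring_scope.

(** Smooth manifolds are given by an atlas, and tensor fields by their
    coordinate expressions in the charts, related on overlaps by the tensor
    transformation law.  As in [jacobian] of mathcomp-analysis, vectors are
    rows and linear maps act on the right: [v *m 'J f x] is the differential
    of [f] at [x] applied to [v].  A list of [k] vectors is the [k x n] matrix
    of its rows. *)

(** * Calculus on open subsets of R^n *)

Section Calculus.
Context {R : realType} {n : nat}.
Notation V := 'rV[R]_n.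

Definition iter_partial (W : normedModType R) (s : seq 'I_n) (f : V -> W) :
    V -> W :=
  foldr (fun i h x => 'D_(delta_mx 0 i) h x) f s.

(* Meant for open [A]. *)
Definition smooth_on (W : normedModType R) (A : set V) (f : V -> W) : Prop :=
  forall (s : seq 'I_n) (x : V), A x -> differentiable (iter_partial s f) x.

Definition lie_bracket (X Y : V -> V) (x : V) : V :=
  'D_(X x) Y x - 'D_(Y x) X x.

Definition bilin (G : 'M[R]_n) (u v : V) : R := (u *m G *m v^T) 0 0.

(* The Lie derivatives are evaluated on constant vector fields, which
   suffices because they are tensorial:
   (L_X g)(u, v) = X (g(u, v)) - g([X, u], v) - g(u, [X, v]). *)
Definition lie_bilin (X : V -> V) (G : V -> 'M[R]_n) (u v : V) (x : V) : R :=
  'D_(X x) (fun y => bilin (G y) u v) x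
  - bilin (G x) (lie_bracket X (cst u) x) v
  - bilin (G x) u (lie_bracket X (cst v) x).

(* (L_X J)(v) = [X, J v] - J [X, v]. *)
Definition lie_endo (X : V -> V) (J : V -> 'M[R]_n) (v : V) (x : V) : V :=
  lie_bracket X (fun y => v *m J y) x - lie_bracket X (cst v) x *m J x.

(* Invariant formula for the exterior derivative, on constant vector fields
   (whose brackets vanish). *)
Definition ext_d (k : nat) (alpha : V -> 'M[R]_(k, n) -> R) (x : V)
    (v : 'M[R]_(k.+1, n)) : R :=
  \sum_(a < k.+1)
    (-1) ^+ a * 'D_(row a v) (fun y => alpha y (row' a v)) x.

End Calculus.

(** * Alternating forms on a vector space *)

Section Forms.
Context {R : realType} {n : nat}.

(* Same formulation as [determinant_multilinear]. *)
Definition multilinear_form (k : nat) (f : 'M[R]_(k, n) -> R) : Prop :=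
  forall (u v w : 'M[R]_(k, n)) (a : 'I_k) (b c : R),
    row a u = b *: row a v + c *: row a w ->
    row' a v = row' a u -> row' a w = row' a u ->
    f u = b * f v + c * f w.

Definition alternating_form (k : nat) (f : 'M[R]_(k, n) -> R) : Prop :=
  forall (v : 'M[R]_(k, n)) (a b : 'I_k),
    a != b -> row a v = row b v -> f v = 0.

(* Normalized so that (dx /\ dy)(e_x, e_y) = 1. *)
Definition wedge (K : fieldType) (p q : nat)
    (f : 'M[R]_(p, n) -> K) (g : 'M[R]_(q, n) -> K)
    (v : 'M[R]_(p + q, n)) : K :=
  ((p`! * q`!)%:R)^-1 *
  \sum_(s : 'S_(p + q))
    (-1) ^+ s * f (usubmx (row_perm s v)) * g (dsubmx (row_perm s v)).

End Forms.

(** * Smooth manifolds *)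

Record manifold (R : realType) (n : nat) := Manifold {
  manifold_sort :> topologicalType;
  chart : Type;
  chart_dom : chart -> set manifold_sort;
  chart_map : chart -> manifold_sort -> 'rV[R]_n;
  chart_inv : chart -> 'rV[R]_n -> manifold_sort;
  manifold_hausdorff : hausdorff_space manifold_sort;
  manifold_second_countable : @second_countable manifold_sort;
  chart_cover : forall p : manifold_sort, exists c : chart, chart_dom c p;
  chart_dom_open : forall c, open (chart_dom c);
  chart_img_open : forall c, open (chart_map c @` chart_dom c);
  chart_mapK : forall c p, chart_dom c p -> chart_inv c (chart_map c p) = p;
  chart_map_continuous : forall c,
    {within chart_dom c, continuous (chart_map c)};
  chart_inv_continuous : forall c,
    {within chart_map c @` chart_dom c, continuous (chart_inv c)};
  transition_smooth : forall c c',
    smooth_on (chart_map c @` (chart_dom c `&` chart_dom c'))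
              (chart_map c' \o chart_inv c)
}.

Section Fields.
Context {R : realType} {n : nat}.
Implicit Type M : manifold R n.

Definition chart_img M (c : chart M) : set 'rV[R]_n :=
  chart_map c @` chart_dom c.

Definition overlap M (c c' : chart M) : set 'rV[R]_n :=
  chart_map c @` (chart_dom c `&` chart_dom c').

Definition transition M (c c' : chart M) : 'rV[R]_n -> 'rV[R]_n :=
  chart_map c' \o chart_inv c.

(** Orientation, as given by an oriented atlas. *)
Definition oriented M : Prop :=
  forall (c c' : chart M) (x : 'rV[R]_n),
    overlap c c' x -> 0 < \det ('J (transition c c') x).

Record vector_field M := VectorField {
  vf :> chart M -> 'rV[R]_n -> 'rV[R]_n;
  vf_smooth : forall c, smooth_on (chart_img c) (vf c);
  vf_transform : forall c c' x, overlap c c' x ->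
    vf c' (transition c c' x) = vf c x *m 'J (transition c c') x
}.

Record endo_field M := EndoField {
  ef :> chart M -> 'rV[R]_n -> 'M[R]_n;
  ef_smooth : forall c, smooth_on (chart_img c) (ef c);
  ef_transform : forall c c' x, overlap c c' x ->
    ef c x *m 'J (transition c c') x =
    'J (transition c c') x *m ef c' (transition c c' x)
}.

Record riemannian_metric M := RiemannianMetric {
  gram :> chart M -> 'rV[R]_n -> 'M[R]_n;
  gram_smooth : forall c, smooth_on (chart_img c) (gram c);
  gram_sym : forall c x, chart_img c x -> (gram c x)^T = gram c x;
  gram_pos : forall c x (v : 'rV[R]_n),
    chart_img c x -> v != 0 -> 0 < bilin (gram c x) v v;
  gram_transform : forall c c' x, overlap c c' x ->
    gram c x =
    'J (transition c c') x *m gram c' (transition c c' x)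
      *m ('J (transition c c') x)^T
}.

Record diff_form M (k : nat) := DiffForm {
  df :> chart M -> 'rV[R]_n -> 'M[R]_(k, n) -> R;
  df_smooth : forall c (v : 'M[R]_(k, n)),
    smooth_on (chart_img c) (fun x => df c x v : R^o);
  df_multilinear : forall c x, chart_img c x -> multilinear_form (df c x);
  df_alternating : forall c x, chart_img c x -> alternating_form (df c x);
  df_transform : forall c c' x (v : 'M[R]_(k, n)), overlap c c' x ->
    df c x v = df c' (transition c c' x) (v *m 'J (transition c c') x)
}.

(* The Riemannian volume form in the charts of an oriented atlas. *)
Definition riem_vol M (g : riemannian_metric M) (c : chart M) (x : 'rV[R]_n)
    (v : 'M[R]_n) : R :=
  Num.sqrt (\det (g c x)) * \det v.

Definition killing M (g : riemannian_metric M) (X : vector_field M) : Prop :=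
  forall c x (u v : 'rV[R]_n), chart_img c x ->
    lie_bilin (X c) (g c) u v x = 0.

Definition preserves_endo M (J : endo_field M) (X : vector_field M) : Prop :=
  forall c x (v : 'rV[R]_n), chart_img c x -> lie_endo (X c) (J c) v x = 0.

Definition commuting M (X Y : vector_field M) : Prop :=
  forall c x, chart_img c x -> lie_bracket (X c) (Y c) x = 0.

Definition lin_indep_fields M (d : nat) (X : 'I_d -> vector_field M) : Prop :=
  forall a : 'I_d -> R,
    (forall c x, chart_img c x -> \sum_(l < d) a l *: X l c x = 0) ->
    forall l, a l = 0.

End Fields.

(** * SU(3)-structures and nearly Kaehler structures *)

Section SU3.
Context {R : realType}.
Variable M : manifold R 6.
Notation V := 'rV[R]_6.

Definition fund_form (g : riemannian_metric M) (J : endo_field M)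
    (c : chart M) (x : V) (v : 'M[R]_(2, 6)) : R :=
  bilin (g c x) (row 0 v *m J c x) (row 1 v).

Definition cplx_form (psip psim : diff_form M 3)
    (c : chart M) (x : V) (v : 'M[R]_(3, 6)) : R[i] :=
  (psip c x v +i* psim c x v)%C.

Record SU3_structure := SU3Structure {
  metric : riemannian_metric M;
  acs : endo_field M;
  psip : diff_form M 3;
  psim : diff_form M 3;
  SU3_oriented : oriented M;
  acs_sq : forall c x, chart_img c x -> acs c x *m acs c x = - 1%:M;
  acs_compatible : forall c x (u v : V), chart_img c x ->
    bilin (metric c x) (u *m acs c x) (v *m acs c x) = bilin (metric c x) u v;
  (* vol_g = omega^3 / 6 *)
  SU3_vol : forall c x (v : 'M[R]_6), chart_img c x ->
    riem_vol metric c x v =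
    6^-1 * wedge (wedge (fund_form metric acs c x) (fund_form metric acs c x))
                 (fund_form metric acs c x) v;
  (* psi has type (3,0): psi(.., J Y, ..) = i psi(.., Y, ..) *)
  psi_type30 : forall c x (v w : 'M[R]_(3, 6)) (a : 'I_3), chart_img c x ->
    row a w = row a v *m acs c x -> row' a w = row' a v ->
    cplx_form psip psim c x w = 'i%C * cplx_form psip psim c x v;
  (* psi /\ conj psi = - 8 i vol_g *)
  psi_norm : forall c x (v : 'M[R]_6), chart_img c x ->
    wedge (cplx_form psip psim c x)
          (fun w => ((cplx_form psip psim c x w)^*)%C) v =
    - 8 * 'i%C * (riem_vol metric c x v)%:C%C
}.

Definition omega (S : SU3_structure) := fund_form (metric S) (acs S).

Definition strict_nearly_kahler (S : SU3_structure) : Prop :=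
  (* d omega = 3 psi^+ *)
  (forall c x (v : 'M[R]_(3, 6)), chart_img c x ->
     ext_d (omega S c) x v = 3 * psip S c x v) /\
  (* d psi^- = - 2 omega /\ omega *)
  (forall c x (v : 'M[R]_(4, 6)), chart_img c x ->
     ext_d (psim S c) x v = - 2 * wedge (omega S c x) (omega S c x) v).

End SU3.

(* Main.v *)
(** Let X, Y, Z be three of the fields.  At a point where psi^-(X, Y, Z) is
    nonzero, X, Y, Z are linearly independent over C, so the open set where this
    function does not vanish is the required M_0; only its density is at stake.

    All the fields preserve omega, psi^+ = d omega / 3 and hence, preserving J,
    also psi^-.  As they commute, Cartan's formula gives
    d (omega (X, Y)) = 3 psi^+ (X, Y, .) and
    d (psi^- (X, Y, Z)) = 2 (omega /\ omega) (X, Y, Z, .) up to sign.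
    If psi^- (X, Y, Z) vanishes on an open set U, then nondegeneracy of omega
    yields omega(X,Y) Z - omega(X,Z) Y + omega(Y,Z) X = 0 on U.  If one of these
    coefficients is nonzero somewhere, one field is a combination of the two
    others with function coefficients; the Killing equation and commutation force
    these functions to be constant.  If all three vanish on U, then
    psi^+ (X, Y, .) = 0, so Y is a complex multiple of X, a real one since
    omega (X, Y) = 0, and again the factor is locally constant.  Either way a
    nontrivial constant combination of X, Y, Z, which is a Killing field, vanishes
    on an open set.  Its second derivatives being linear in its 1-jet, Gronwall's
    lemma shows that it vanishes in every chart ball around a limit point of the
    interior of its zero set, hence on the connected manifold M, contradicting
    linear independence. *)

From HB Require Import structures.
From mathcomp Require Import all_boot all_order all_algebra all_fingroup.
From mathcomp Require Import all_classical all_reals all_analysis.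
From mathcomp Require Import complex ring lra.
Require Import Defs.

Set Implicit Arguments.
Unset Strict Implicit.
Unset Printing Implicit Defensive.

Import Order.TTheory GRing.Theory Num.Theory numFieldNormedType.Exports.
Local Open Scope classical_set_scope.
Local Open Scope ring_scope.

(** * Differential calculus *)

Section DirectionalDerivatives.
Context {R : realType} {n : nat}.
Notation V := 'rV[R]_n.
Implicit Types (A : set V) (x y u v : V).

Lemma near_in A (P : V -> Prop) x :
  open A -> A x -> (forall y, A y -> P y) -> \forall y \near x, P y.
Proof.
by move=> oA Ax AP; apply: filterS (open_nbhs_nbhs (conj oA Ax)).
Qed.

Lemma eq_derive_in A (W : normedModType R) (f g : V -> W) x v :
  open A -> A x -> (forall y, A y -> f y = g y) -> 'D_v f x = 'D_v g x.
Proof. by move=> oA Ax fg; apply: near_eq_derive; apply: near_in fg. Qed.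

Lemma eq_differentiable_in A (W : normedModType R) (f g : V -> W) x :
  open A -> A x -> (forall y, A y -> f y = g y) ->
  differentiable f x -> differentiable g x.
Proof.
move=> oA Ax fg df.
have [cdf /eqaddoP fo] := (diff_locallyP x f).1 df.
have go : g \o shift x = cst (g x) + 'd f x +o_ (0 : V) id.
  apply/eqaddoP => e e0; have := fo e e0.
  have : \forall y \near (0 : V), A (y + x).
    have : \forall y \near x, A y by exact: open_nbhs_nbhs.
    by rewrite (near_shift 0 x) /= subr0.
  apply: filterS2 => y Ay /=.
  by rewrite !fctE /= -(fg _ Ay) -(fg _ Ax).
by apply/diff_locallyP; rewrite (diff_unique cdf go).
Unshelve. all: by end_near. Qed.

Lemma derive_sum_coord (W : normedModType R) (f : V -> W) x v :
  differentiable f x -> 'D_v f x = \sum_i v 0 i *: 'D_(delta_mx 0 i) f x.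
Proof.
move=> df; rewrite deriveE// {1}(row_sum_delta v) linear_sum.
by apply: eq_bigr => i _; rewrite linearZ deriveE.
Qed.

Lemma derive_dirP (W : normedModType R) (f : V -> W) x (a : R) u v :
  differentiable f x -> 'D_(a *: u + v) f x = a *: 'D_u f x + 'D_v f x.
Proof. by move=> df; rewrite !deriveE// linearP. Qed.

Lemma derive_line (W : normedModType R) (f : V -> W) x v (t : R) :
  differentiable f (x + t *: v) ->
  is_derive t 1 (fun s : R => f (x + s *: v)) ('D_v f (x + t *: v)).
Proof.
move=> df.
have E : (fun h : R => h^-1 *: (f (x + (h *: (1:R) + t) *: v) - f (x + t *: v))) =
  (fun h => h^-1 *: (f (h *: v + (x + t *: v)) - f (x + t *: v))).
  by apply/funext => h; rewrite scaler1 scalerDl addrCA.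
have dv : derivable f (x + t *: v) v by exact: diff_derivable.
split.
  by rewrite /derivable /= E.
by rewrite /derive /= E.
Qed.

Lemma differentiable_littleo (W : normedModType R) (g : V -> W) x (e : R) :
  differentiable g x -> 0 < e ->
  \forall h \near (0 : V), `|g (h + x) - g x - 'd g x h| <= e * `|h|.
Proof.
move=> dg e0; have [_ /eqaddoP go] := (diff_locallyP x g).1 dg.
have := go e e0; apply: filterS => h /=.
by rewrite !fctE /= opprD addrA.
Qed.

Lemma derive_comb (h1 h2 h : V -> R) (k : R) y p :
  (forall z, h z = k * h1 z + h2 z) ->
  differentiable h1 y -> differentiable h2 y ->
  'D_p h y = k * 'D_p h1 y + 'D_p h2 y.
Proof.
move=> hE d1 d2; have -> : h = (k *: h1) + h2 by apply/funext => z; rewrite hE.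
have D1 : derivable h1 y p by exact: diff_derivable.
by rewrite deriveD ?deriveZ//; [exact: derivableZ|exact: diff_derivable].
Qed.

End DirectionalDerivatives.

Section SmoothFunctions.
Context {R : realType} {n : nat}.
Notation V := 'rV[R]_n.
Variable A : set V.
Hypothesis oA : open A.

Fixpoint Ck (W : normedModType R) (k : nat) (f : V -> W) : Prop :=
  (forall x, A x -> differentiable f x) /\
  (if k is k'.+1 then forall i, Ck k' (fun x => 'D_(delta_mx 0 i) f x)
   else True).

Lemma smooth_onP (W : normedModType R) (f : V -> W) :
  smooth_on A f <-> forall k, Ck k f.
Proof.
split=> [sf k|Cf s x Ax].
  elim: k f sf => [|k IH] f sf; split => //; try exact: (sf [::]).
  move=> i; apply: IH => s x Ax; have := sf (rcons s i) x Ax.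
  by rewrite /iter_partial foldr_rcons.
elim/last_ind: s f Cf => [|s i IH] f Cf; first exact: (Cf 0%N).1.
rewrite /iter_partial foldr_rcons; apply: IH => k.
exact: (Cf k.+1).2.
Qed.

Lemma eq_Ck (W : normedModType R) k (f g : V -> W) :
  (forall y, A y -> f y = g y) -> Ck k f -> Ck k g.
Proof.
elim: k f g => [|k IH] f g fg [df Cf]; split=> //.
- by move=> x Ax; apply: eq_differentiable_in oA Ax fg (df _ Ax).
- by move=> x Ax; apply: eq_differentiable_in oA Ax fg (df _ Ax).
- move=> i; apply: IH (Cf i).
  by move=> y Ay; exact: (eq_derive_in _ oA Ay fg).
Qed.

Lemma CkS (W : normedModType R) k (f : V -> W) : Ck k.+1 f -> Ck k f.
Proof.
elim: k f => [|k IH] f [df Cf]; split=> //.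
by move=> i; apply: IH.
Qed.

Lemma CkD (W : normedModType R) k (f g : V -> W) :
  Ck k f -> Ck k g -> Ck k (fun x => f x + g x).
Proof.
elim: k f g => [|k IH] f g [df Cf] [dg Cg]; split=> //.
- by move=> x Ax; apply: differentiableD; [exact: df|exact: dg].
- by move=> x Ax; apply: differentiableD; [exact: df|exact: dg].
- move=> i; apply: eq_Ck (IH _ _ (Cf i) (Cg i)) => x Ax.
  by rewrite -deriveD //; apply: diff_derivable; [exact: df|exact: dg].
Qed.

Lemma Ck_cst (W : normedModType R) k (a : W) : Ck k (fun=> a).
Proof.
elim: k a => [|k IH] a; split=> //; try by move=> x _; exact: differentiable_cst.
by move=> i; apply: eq_Ck (IH 0) => x Ax; rewrite derive_cst.
Qed.

Lemma CkM k (f g : V -> R) : Ck k f -> Ck k g -> Ck k (fun x => f x * g x).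
Proof.
elim: k f g => [|k IH] f g /[dup] Ckf [df Cf] /[dup] Ckg [dg Cg]; split=> //.
- by move=> x Ax; apply: differentiableM; [exact: df|exact: dg].
- by move=> x Ax; apply: differentiableM; [exact: df|exact: dg].
- move=> i.
  apply: eq_Ck (CkD (IH _ _ (CkS Ckf) (Cg i)) (IH _ _ (CkS Ckg) (Cf i))).
  move=> x Ax /=.
  by rewrite -[_ * 'D__ g x]/(_ *: 'D__ g x) -[_ * 'D__ f x]/(_ *: 'D__ f x)
     -deriveM //; apply: diff_derivable; [exact: df|exact: dg].
Qed.

Lemma smooth_on_differentiable (W : normedModType R) (f : V -> W) x :
  smooth_on A f -> A x -> differentiable f x.
Proof. by move=> sf; exact: (sf [::]). Qed.

Lemma smooth_on_eq (W : normedModType R) (f g : V -> W) :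
  (forall y, A y -> f y = g y) -> smooth_on A f -> smooth_on A g.
Proof. by move=> fg /smooth_onP Cf; apply/smooth_onP => k; exact: eq_Ck fg _. Qed.

Lemma smooth_on_cst (W : normedModType R) (a : W) : smooth_on A (fun=> a).
Proof. by apply/smooth_onP => k; exact: Ck_cst. Qed.

Lemma smooth_onD (W : normedModType R) (f g : V -> W) :
  smooth_on A f -> smooth_on A g -> smooth_on A (fun x => f x + g x).
Proof.
by move=> /smooth_onP Cf /smooth_onP Cg; apply/smooth_onP => k; exact: CkD.
Qed.

Lemma smooth_onM (f g : V -> R) :
  smooth_on A f -> smooth_on A g -> smooth_on A (fun x => f x * g x).
Proof.
by move=> /smooth_onP Cf /smooth_onP Cg; apply/smooth_onP => k; exact: CkM.
Qed.

Lemma smooth_on_sum (W : normedModType R) (I : Type) (r : seq I) (P : pred I)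
    (f : I -> V -> W) :
  (forall i, P i -> smooth_on A (f i)) ->
  smooth_on A (fun x => \sum_(i <- r | P i) f i x).
Proof.
move=> sf; rewrite (_ : (fun x => _) = \sum_(i <- r | P i) f i); last first.
  by apply/funext => x; rewrite fct_sumE.
by elim/big_ind : _ => //; [exact: smooth_on_cst|exact: smooth_onD].
Qed.

Lemma smooth_on_prod (I : Type) (r : seq I) (P : pred I) (f : I -> V -> R) :
  (forall i, P i -> smooth_on A (f i)) ->
  smooth_on A (fun x => \prod_(i <- r | P i) f i x).
Proof.
move=> sf; rewrite (_ : (fun x => _) = \prod_(i <- r | P i) f i); last first.
  by apply/funext => x; rewrite fct_prodE.
by elim/big_ind : _ => //; [exact: smooth_on_cst|exact: smooth_onM].
Qed.

Lemma smooth_on_partial (W : normedModType R) (f : V -> W) i :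
  smooth_on A f -> smooth_on A (fun x => 'D_(delta_mx 0 i) f x).
Proof.
by move=> /smooth_onP Cf; apply/smooth_onP => k; exact: (Cf k.+1).2.
Qed.

Lemma CkZ (W : normedModType R) k (a : R) (f : V -> W) :
  Ck k f -> Ck k (fun x => a *: f x).
Proof.
elim: k f => [|k IH] f [df Cf]; split=> //.
- by move=> x Ax; apply: differentiableZ; exact: df.
- by move=> x Ax; apply: differentiableZ; exact: df.
- move=> i; apply: eq_Ck (IH _ (Cf i)) => x Ax.
  by rewrite -deriveZ//; apply: diff_derivable; exact: df.
Qed.

Lemma smooth_onZ (W : normedModType R) (a : R) (f : V -> W) :
  smooth_on A f -> smooth_on A (fun x => a *: f x).
Proof. by move=> /smooth_onP Cf; apply/smooth_onP => k; exact: CkZ. Qed.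

Lemma smooth_on_derive (W : normedModType R) (f : V -> W) v :
  smooth_on A f -> smooth_on A (fun x => 'D_v f x).
Proof.
move=> sf; apply: (@smooth_on_eq _ (fun x => \sum_i v 0 i *: 'D_(delta_mx 0 i) f x)).
  by move=> y Ay; rewrite [RHS]derive_sum_coord//; exact: smooth_on_differentiable.
by apply: smooth_on_sum => i _; apply: smooth_onZ; exact: smooth_on_partial.
Qed.

Lemma derive_entry p q (f : V -> 'M[R]_(p, q)) x v i j :
  differentiable f x -> ('D_v f x) i j = 'D_v (fun y => f y i j) x.
Proof. by move=> df; rewrite derive_mx ?mxE//; exact: diff_derivable. Qed.

Lemma differentiable_entry p q (f : V -> 'M[R]_(p, q)) x i j :
  differentiable f x -> differentiable (fun y => f y i j) x.
Proof.
move=> df; apply: (@differentiable_comp _ _ _ _ f (fun N : 'M[R]_(p, q) => N i j)) => //.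
exact: differentiable_coord.
Qed.

Lemma differentiable_row m (f : V -> 'rV[R]_m) x :
  (forall j, differentiable (fun y => f y 0 j) x) -> differentiable f x.
Proof.
move=> df; rewrite (_ : f = \sum_(j < m) (fun y => f y 0 j *: delta_mx 0 j)).
  by apply: differentiable_sum => j; exact: differentiableZl.
by apply/funext => y; rewrite fct_sumE [LHS]row_sum_delta.
Qed.

Lemma smooth_on_entry p q (f : V -> 'M[R]_(p, q)) i j :
  smooth_on A f -> smooth_on A (fun x => f x i j).
Proof.
move=> /smooth_onP Cf; apply/smooth_onP => k; move/(_ k) : Cf.
elim: k f => [|k IH] f [df Cf]; split => //.
- by move=> x Ax; exact/differentiable_entry/df.
- by move=> x Ax; exact/differentiable_entry/df.
- move=> l; apply: eq_Ck (IH _ (Cf l)) => x Ax.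
  by rewrite derive_entry//; exact: df.
Qed.

End SmoothFunctions.

Section Schwarz.
Context {R : realType} {n : nat}.
Notation V := 'rV[R]_n.
Variables (A : set V) (f : V -> R) (x : V).
Hypotheses (oA : open A) (Ax : A x).
Hypothesis df : forall y, A y -> differentiable f y.

(* The mixed second difference of [f] is [h ^+ 2] times the second derivative
   up to [o(h ^+ 2)], and it is symmetric in [u] and [v]. *)
Lemma mixed_difference (u v : V) (e : R) :
  differentiable (fun y => 'D_u f y) x -> 0 < e ->
  exists2 d : R, 0 < d & forall h, 0 < h -> h < d ->
    `|f (x + h *: u + h *: v) - f (x + h *: u) - f (x + h *: v) + f x
      - h ^+ 2 * 'D_v (fun y => 'D_u f y) x| <= e * h ^+ 2.
Proof.
move=> ddf e0; set D := fun y => 'D_u f y.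
pose N := `|u| + `|v|.
have N0 : 0 <= N by rewrite addr_ge0.
have N1 : 0 < 2 * (N + 1) by lra.
have e'0 : 0 < e / (2 * (N + 1)) by rewrite divr_gt0.
have nA : \forall w \near (0 : V), A (w + x).
  have : \forall y \near x, A y by exact: open_nbhs_nbhs.
  by rewrite (near_shift 0 x) /= subr0.
have : \forall w \near (0 : V),
    A (w + x) /\ `|D (w + x) - D x - 'd D x w| <= e / (2 * (N + 1)) * `|w|.
  exact: filterI nA (differentiable_littleo ddf e'0).
move=> /nbhs_normP[r r0 Hr].
have {}Hr w : `|w| < r -> A (x + w) /\
    `|D (x + w) - D x - 'd D x w| <= e / (2 * (N + 1)) * `|w|.
  move=> wr; rewrite (addrC x); apply: Hr.
  by rewrite /ball_ /= sub0r normrN.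
exists (r / (N + 1)) => [|h h0 hd]; first by rewrite divr_gt0//; lra.
have hr : h * N < r.
  by move: hd; rewrite ltr_pdivlMr; [move=> hd; nra|lra].
have small c (b : bool) : 0 <= c -> c <= h ->
    `|c *: u + (if b then h else 0) *: v| <= h * N.
  move=> c0 ch; apply: le_trans (ler_normD _ _) _.
  rewrite !normrZ (ger0_norm c0) /N mulrDr lerD ?ler_wpM2r//.
  by case: b => /=; [rewrite gtr0_norm|rewrite normr0 ltW].
have inA c b : 0 <= c -> c <= h -> A (x + (c *: u + (if b then h else 0) *: v)).
  by move=> c0 ch; apply: (Hr _ _).1; exact: le_lt_trans (small c b c0 ch) hr.
pose phi (s : R) := f (x + h *: v + s *: u) - f (x + s *: u).
have dphi s : 0 <= s -> s <= h ->
    is_derive s 1 phi (D (x + h *: v + s *: u) - D (x + s *: u)).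
  move=> s0 sh; apply: is_deriveB; apply: derive_line; apply: df.
    by have := inA s true s0 sh; rewrite [X in _ + X]addrC addrA.
  by have := inA s false s0 sh; rewrite scale0r addr0.
have cphi : {within `[0, h], continuous phi}.
  apply: derivable_within_continuous => s; rewrite in_itv/= => /andP[s0 sh].
  by have [] := dphi s s0 sh.
have [|c] := MVT h0 _ cphi (df := fun s => D (x + h *: v + s *: u) - D (x + s *: u)).
  by move=> s; rewrite in_itv/= => /andP[s0 sh]; apply: dphi; exact: ltW.
rewrite in_itv/= => /andP[/ltW c0 /ltW ch] E.
have -> : f (x + h *: u + h *: v) - f (x + h *: u) - f (x + h *: v) + f x =
    phi h - phi 0.
  rewrite /phi scale0r !addr0 (addrAC x (h *: u)).
  by rewrite opprB addrA; ring.
rewrite E subr0.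
have K1 := (Hr _ (le_lt_trans (small c true c0 ch) hr)).2.
have K2 := (Hr _ (le_lt_trans (small c false c0 ch) hr)).2.
have {}K1 := le_trans K1 (ler_wpM2l (ltW e'0) (small c true c0 ch)).
have {}K2 := le_trans K2 (ler_wpM2l (ltW e'0) (small c false c0 ch)).
move: K1 K2; rewrite scale0r addr0 (addrC (c *: u)) linearP.
rewrite addrA (deriveE _ ddf).
set a := D (x + _ + _); set b := D (x + _); set L := 'd D x v; set L' := 'd D x _.
have -> : (a - b) * h - h ^+ 2 * L =
  h * ((a - D x - (h *: L + L')) - (b - D x - L')) by rewrite /GRing.scale /=; ring.
have bnd : e / (2 * (N + 1)) * (h * N) <= e / 2 * h.
  have -> : e / (2 * (N + 1)) * (h * N) = e / 2 * h * (N / (N + 1)).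
    by field; lra.
  rewrite ger_pMr; first by rewrite ler_pdivrMr; lra.
  by rewrite mulr_gt0// divr_gt0.
move=> /le_trans/(_ bnd) K1 /le_trans/(_ bnd) K2.
rewrite normrM (gtr0_norm h0) expr2 mulrCA ler_pM2l//.
apply: le_trans (ler_normB _ _) _; apply: le_trans (lerD K1 K2) _.
by rewrite -mulrDl -splitr.
Qed.

Lemma derive_comm (u v : V) :
  differentiable (fun y => 'D_u f y) x ->
  differentiable (fun y => 'D_v f y) x ->
  'D_v (fun y => 'D_u f y) x = 'D_u (fun y => 'D_v f y) x.
Proof.
move=> du dv; apply/eqP; rewrite -subr_eq0 -normr_le0.
apply/ler_addgt0Pr => e e0; rewrite add0r.
have e2 : 0 < e / 4 by rewrite divr_gt0.
have [d1 d10 H1] := mixed_difference v du e2.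
have [d2 d20 H2] := mixed_difference u dv e2.
pose h := Num.min d1 d2 / 2.
have m0 : 0 < Num.min d1 d2 by rewrite lt_min d10.
have h0 : 0 < h by rewrite divr_gt0.
have hm : h < Num.min d1 d2 by rewrite ltr_pdivrMr // ltr_pMr// ltr1n.
have := H1 h h0 (lt_le_trans hm _); rewrite ge_min lexx => /(_ isT) K1.
have := H2 h h0 (lt_le_trans hm _); rewrite ge_min lexx orbT => /(_ isT).
rewrite (addrAC x (h *: v)) (addrAC (f _) (- f (x + h *: v))) => K2.
rewrite -(@ler_pM2l _ (h ^+ 2)) ?exprn_gt0//.
rewrite -[X in X * `|_|]ger0_norm ?exprn_ge0 ?ltW// -normrM.
move: K1 K2; move: (_ + f x) ('D_v _ x) ('D_u _ x) => X a b.
have he : 0 < h ^+ 2 * e by rewrite mulr_gt0// exprn_gt0.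
by rewrite !ler_norml ltr_norml => /andP[? ?] /andP[? ?]; apply/andP; split; lra.
Qed.

End Schwarz.

Section SlotRule.
Context {R : realType} {n : nat}.
Notation V := 'rV[R]_n.
Variables (A : set V) (x : V).
Hypotheses (oA : open A) (Ax : A x).

Lemma scalar_sum m (phi : 'rV[R]_m -> R) : scalar phi ->
  forall b, phi b = \sum_i b 0 i * phi (delta_mx 0 i).
Proof.
move=> phi_lin b.
pose p := GRing.isLinear.Build R 'rV[R]_m R *%R phi phi_lin.
pose phi' : {linear 'rV[R]_m -> R | *%R} := HB.pack phi p.
rewrite {1}(row_sum_delta b) -[phi]/(phi' : _ -> _) linear_sum.
by apply: eq_bigr => i _; rewrite linearZ.
Qed.

Lemma derive_slot m (phi : V -> 'rV[R]_m -> R) (B : V -> 'rV[R]_m) :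
  (forall y, A y -> scalar (phi y)) ->
  (forall b, differentiable (phi^~ b) x) -> differentiable B x ->
  differentiable (fun y => phi y (B y)) x /\
  forall v, 'D_v (fun y => phi y (B y)) x =
    'D_v (fun y => phi y (B x)) x + phi x ('D_v B x).
Proof.
move=> phi_lin dphi dB.
pose F (b : V -> 'rV[R]_m) := \sum_(i < m) (fun y => b y 0 i * phi y (delta_mx 0 i)).
have FE b y : A y -> F b y = phi y (b y).
  by move=> Ay; rewrite /F fct_sumE (scalar_sum (phi_lin _ Ay) (b y)).
have dF b : differentiable b x -> differentiable (F b) x.
  move=> db; apply: differentiable_sum => i; apply: differentiableM => //.
  exact: differentiable_entry.
have DF b v : differentiable b x -> 'D_v (F b) x =
    \sum_(i < m) (b x 0 i * 'D_v (phi^~ (delta_mx 0 i)) x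
                  + phi x (delta_mx 0 i) * ('D_v b x) 0 i).
  move=> db; have dbi i : derivable (fun y => b y 0 i) x v.
    exact/diff_derivable/differentiable_entry.
  have dpi i : derivable (phi^~ (delta_mx 0 i)) x v by exact: diff_derivable.
  rewrite derive_sum => [|i]; last exact: derivableM (dbi i) (dpi i).
  apply: eq_bigr => i _; rewrite (deriveM (dbi i) (dpi i)).
  by rewrite derive_entry.
have dc : differentiable (fun=> B x : 'rV[R]_m) x by exact: differentiable_cst.
split=> [|v]; first exact: eq_differentiable_in (FE B) (dF _ dB).
rewrite -(eq_derive_in v oA Ax (FE B)) DF//.
rewrite -(eq_derive_in v oA Ax (FE (fun=> B x))) DF//.
rewrite derive_cst (scalar_sum (phi_lin _ Ax) ('D_v B x)) -big_split/=.
by apply: eq_bigr => i _; rewrite mxE mulr0 addr0 [phi x _ * _]mulrC.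
Qed.

Lemma derive_slot2 (phi : V -> V -> V -> R) (B C : V -> V) :
  (forall y c, A y -> scalar (phi y ^~ c)) ->
  (forall y b, A y -> scalar (phi y b)) ->
  (forall b c, differentiable (fun y => phi y b c) x) ->
  differentiable B x -> differentiable C x ->
  differentiable (fun y => phi y (B y) (C y)) x /\
  forall v, 'D_v (fun y => phi y (B y) (C y)) x =
    'D_v (fun y => phi y (B x) (C x)) x
    + phi x ('D_v B x) (C x) + phi x (B x) ('D_v C x).
Proof.
move=> l1 l2 dphi dB dC.
have sC b := @derive_slot n (fun y => phi y b) C (fun y Ay => l2 y b Ay)
               (dphi b) dC.
have [dBC DBC] := @derive_slot n (fun y b => phi y b (C y)) B
   (fun y Ay => l1 y (C y) Ay) (fun b => (sC b).1) dB.
by split=> // v; rewrite DBC (sC (B x)).2 addrAC.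
Qed.

Lemma derive_slot3 (phi : V -> V -> V -> V -> R) (B C D : V -> V) :
  (forall y c d, A y -> scalar (fun b => phi y b c d)) ->
  (forall y b d, A y -> scalar (fun c => phi y b c d)) ->
  (forall y b c, A y -> scalar (phi y b c)) ->
  (forall b c d, differentiable (fun y => phi y b c d) x) ->
  differentiable B x -> differentiable C x -> differentiable D x ->
  differentiable (fun y => phi y (B y) (C y) (D y)) x /\
  forall v, 'D_v (fun y => phi y (B y) (C y) (D y)) x =
    'D_v (fun y => phi y (B x) (C x) (D x)) x
    + phi x ('D_v B x) (C x) (D x) + phi x (B x) ('D_v C x) (D x)
    + phi x (B x) (C x) ('D_v D x).
Proof.
move=> l1 l2 l3 dphi dB dC dD.
have sCD b := @derive_slot2 (fun y => phi y b) C D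
   (fun y d Ay => l2 y b d Ay) (fun y c Ay => l3 y b c Ay) (dphi b) dC dD.
have [dBC DBC] := @derive_slot n (fun y b => phi y b (C y) (D y)) B
   (fun y Ay => l1 y (C y) (D y) Ay) (fun b => (sCD b).1) dB.
by split=> // v; rewrite DBC (sCD (B x)).2; ring.
Qed.

End SlotRule.

(* Without the generalization, [lra] compares derivatives up to conversion, which
   does not terminate in reasonable time. *)
Ltac derive_lra :=
  repeat match goal with
  | |- context [@derive ?K ?U ?W ?f ?x ?v] =>
      let d := fresh "d" in generalize (@derive K U W f x v) => d
  end; lra.

Section LieDerivatives.
Context {R : realType} {n : nat}.
Notation V := 'rV[R]_n.
Variable A : set V.
Hypothesis oA : open A.

Definition bilinear_on (w : V -> V -> V -> R) : Prop :=
  (forall y c, A y -> scalar (w y ^~ c)) /\ (forall y b, A y -> scalar (w y b)).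

Definition trilinear_on (T : V -> V -> V -> V -> R) : Prop :=
  [/\ forall y c d, A y -> scalar (fun b => T y b c d),
      forall y b d, A y -> scalar (fun c => T y b c d) &
      forall y b c, A y -> scalar (T y b c)].

Definition invariant2 (X : V -> V) (w : V -> V -> V -> R) : Prop :=
  forall x b c, A x ->
    'D_(X x) (fun y => w y b c) x + w x ('D_b X x) c + w x b ('D_c X x) = 0.

Definition invariant3 (X : V -> V) (T : V -> V -> V -> V -> R) : Prop :=
  forall x b c d, A x ->
    'D_(X x) (fun y => T y b c d) x
    + T x ('D_b X x) c d + T x b ('D_c X x) d + T x b c ('D_d X x) = 0.

Definition ext_d2 (w : V -> V -> V -> R) (x a b c : V) : R :=
  'D_a (fun y => w y b c) x - 'D_b (fun y => w y a c) x
  + 'D_c (fun y => w y a b) x.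

Definition ext_d3 (T : V -> V -> V -> V -> R) (x a b c d : V) : R :=
  'D_a (fun y => T y b c d) x - 'D_b (fun y => T y a c d) x
  + 'D_c (fun y => T y a b d) x - 'D_d (fun y => T y a b c) x.

Definition commute_on (X Y : V -> V) : Prop :=
  forall x, A x -> 'D_(X x) Y x = 'D_(Y x) X x.

Section TwoForm.
Variable w : V -> V -> V -> R.
Hypothesis w_lin : bilinear_on w.
Hypothesis w_smooth : forall b c, smooth_on A (fun y => w y b c).
Hypothesis w_alt : forall y b c, A y -> w y b c = - w y c b.

Let dw b c x : A x -> differentiable (fun y => w y b c) x.
Proof. by move=> Ax; exact: smooth_on_differentiable. Qed.

Lemma derive_contraction X Y x v : A x -> smooth_on A X -> smooth_on A Y ->
  differentiable (fun y => w y (X y) (Y y)) x /\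
  'D_v (fun y => w y (X y) (Y y)) x =
    'D_v (fun y => w y (X x) (Y x)) x
    + w x ('D_v X x) (Y x) + w x (X x) ('D_v Y x).
Proof.
move=> Ax sX sY; have dX := smooth_on_differentiable sX Ax.
have dY := smooth_on_differentiable sY Ax.
have [d D] := derive_slot2 oA Ax w_lin.1 w_lin.2 (fun b c => dw b c Ax) dX dY.
by split.
Qed.

Lemma ext_d2_contraction X Y x v : A x -> smooth_on A X -> smooth_on A Y ->
  invariant2 X w -> invariant2 Y w -> commute_on X Y ->
  ext_d2 w x (X x) (Y x) v = 'D_v (fun y => w y (X y) (Y y)) x.
Proof.
move=> Ax sX sY LX LY cXY; rewrite (derive_contraction v Ax sX sY).2.
have := LX x (Y x) v Ax; have := LY x (X x) v Ax; rewrite /ext_d2 cXY//.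
have := w_alt ('D_v X x) (Y x) Ax; derive_lra.
Qed.

End TwoForm.

Lemma derive_comm_vec m (X : V -> 'rV[R]_m) x p q : A x -> smooth_on A X ->
  'D_p (fun y => 'D_q X y) x = 'D_q (fun y => 'D_p X y) x.
Proof.
move=> Ax sX; apply/rowP => j.
have dDX r : differentiable (fun y => 'D_r X y) x.
  by apply: smooth_on_differentiable Ax; exact: smooth_on_derive.
have dXj y : A y -> differentiable (fun y => X y 0 j) y.
  by move=> Ay; exact/differentiable_entry/(smooth_on_differentiable sX).
have DXj r y : A y -> 'D_r (fun y => X y 0 j) y = ('D_r X y) 0 j.
  by move=> Ay; rewrite derive_entry//; exact: smooth_on_differentiable Ay.
have dDXj r : differentiable (fun y => 'D_r (fun y => X y 0 j) y) x.
  apply: smooth_on_differentiable Ax; apply: smooth_on_derive => //.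
  exact: smooth_on_entry.
have Ep := derive_entry p 0 j (dDX q); have Eq := derive_entry q 0 j (dDX p).
apply: etrans Ep _; apply: etrans (esym Eq).
apply: etrans (esym (eq_derive_in p oA Ax (DXj q))) _.
apply: etrans (eq_derive_in q oA Ax (DXj p)).
exact: (derive_comm oA Ax dXj).
Qed.

(* The equation [L_X w = 0] differentiated in the direction [p]. *)
Lemma derive_invariant2 X w x p q r : smooth_on A X -> bilinear_on w ->
  (forall b c, smooth_on A (fun y => w y b c)) -> invariant2 X w -> A x ->
  'D_(X x) (fun y => 'D_p (fun y => w y q r) y) x =
   - ('D_('D_p X x) (fun y => w y q r) x
      + 'D_p (fun y => w y ('D_q X x) r) x + w x ('D_p (fun y => 'D_q X y) x) r
      + 'D_p (fun y => w y q ('D_r X x)) x + w x q ('D_p (fun y => 'D_r X y) x)).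
Proof.
move=> sX wl ws LX Ax.
have dX := smooth_on_differentiable sX Ax.
have dw p' q' y : A y -> differentiable (fun y => w y p' q') y.
  by move=> Ay; exact: smooth_on_differentiable (ws p' q') Ay.
have ddw p' : differentiable (fun y => 'D_p' (fun y => w y q r) y) x.
  by apply: smooth_on_differentiable Ax; exact: smooth_on_derive.
have dDX p' : differentiable (fun y => 'D_p' X y) x.
  by apply: smooth_on_differentiable Ax; exact: smooth_on_derive.
have -> : 'D_(X x) (fun y => 'D_p (fun y => w y q r) y) x =
    'D_p (fun y => 'D_(X x) (fun y => w y q r) y) x.
  by apply: (derive_comm oA Ax (dw q r)); exact: ddw.
have [dh Dh] := derive_slot oA Ax (phi := fun y u => 'D_u (fun y => w y q r) y)
  (fun y Ay k u v => derive_dirP k u v (dw q r y Ay)) ddw dX.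
have [d1 D1] := derive_slot oA Ax (phi := fun y u => w y u r)
  (fun y Ay => wl.1 y r Ay) (fun u => dw u r x Ax) (dDX q).
have [d2 D2] := derive_slot oA Ax (phi := fun y u => w y q u)
  (fun y Ay => wl.2 y q Ay) (fun u => dw q u x Ax) (dDX r).
have E y : A y -> 'D_(X y) (fun y => w y q r) y =
    - (w y ('D_q X y) r + w y q ('D_r X y)).
  by move=> Ay; have := LX y q r Ay; derive_lra.
have := eq_derive_in p oA Ax E; rewrite Dh.
have -> : 'D_p (fun y => - (w y ('D_q X y) r + w y q ('D_r X y))) x =
    - ('D_p (fun y => w y ('D_q X y) r) x + 'D_p (fun y => w y q ('D_r X y)) x).
  rewrite -deriveD; [|exact: diff_derivable|exact: diff_derivable].
  by apply: deriveN; apply: diff_derivable; exact: differentiableD.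
rewrite D1 D2; derive_lra.
Qed.

Lemma ext_d2_invariant X w : smooth_on A X -> bilinear_on w ->
  (forall b c, smooth_on A (fun y => w y b c)) ->
  (forall y b c, A y -> w y b c = - w y c b) ->
  invariant2 X w -> invariant3 X (ext_d2 w).
Proof.
move=> sX wl ws walt LX x a b c Ax.
have ddw p q r : differentiable (fun y => 'D_p (fun y => w y q r) y) x.
  by apply: smooth_on_differentiable Ax; exact: smooth_on_derive.
have key p q r := derive_invariant2 p q r sX wl ws LX Ax.
have DXC p q := derive_comm_vec p q Ax sX.
have Dadd p (h1 h2 : V -> R) : differentiable h1 x -> differentiable h2 x ->
    'D_p (fun y => h1 y + h2 y) x = 'D_p h1 x + 'D_p h2 x.
  by move=> d1 d2; apply: deriveD; exact: diff_derivable.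
have Dsub p (h1 h2 : V -> R) : differentiable h1 x -> differentiable h2 x ->
    'D_p (fun y => h1 y - h2 y) x = 'D_p h1 x - 'D_p h2 x.
  by move=> d1 d2; apply: deriveB; exact: diff_derivable.
rewrite /ext_d2 Dadd//; last exact: differentiableB.
rewrite (Dsub _ _ _ (ddw a b c) (ddw b a c)).
have := key a b c; have := key b a c; have := key c a b.
have := congr1 (w x ^~ c) (DXC b a); have := congr1 (w x ^~ b) (DXC c a).
have := congr1 (w x a) (DXC c b).
have := walt _ ('D_a (fun y => 'D_c X y) x) b Ax; derive_lra.
Qed.

Section ThreeForm.
Variable T : V -> V -> V -> V -> R.
Hypothesis T_lin : trilinear_on T.
Hypothesis T_smooth : forall b c d, smooth_on A (fun y => T y b c d).
Hypothesis T_alt12 : forall y b c d, A y -> T y b c d = - T y c b d.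
Hypothesis T_alt23 : forall y b c d, A y -> T y b c d = - T y b d c.

Lemma ext_d3_contraction X Y Z x v : A x ->
  smooth_on A X -> smooth_on A Y -> smooth_on A Z ->
  invariant3 X T -> invariant3 Y T -> invariant3 Z T ->
  commute_on X Y -> commute_on X Z -> commute_on Y Z ->
  ext_d3 T x (X x) (Y x) (Z x) v =
    - 'D_v (fun y => T y (X y) (Y y) (Z y)) x.
Proof.
move=> Ax sX sY sZ LX LY LZ cXY cXZ cYZ; have [l1 l2 l3] := T_lin.
have dX := smooth_on_differentiable sX Ax.
have dY := smooth_on_differentiable sY Ax.
have dZ := smooth_on_differentiable sZ Ax.
have dT b c d : differentiable (fun y => T y b c d) x.
  exact: smooth_on_differentiable.
rewrite (derive_slot3 oA Ax l1 l2 l3 dT dX dY dZ).2.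
have := LX x (Y x) (Z x) v Ax; have := LY x (X x) (Z x) v Ax.
have := LZ x (X x) (Y x) v Ax; rewrite /ext_d3 cXY// cXZ// cYZ//.
have := T_alt12 ('D_v X x) (Y x) (Z x) Ax.
have := T_alt23 (Y x) ('D_v X x) (Z x) Ax.
have := T_alt23 (X x) ('D_v Y x) (Z x) Ax.
have := T_alt12 ('D_(Z x) X x) (Y x) v Ax.
have := T_alt12 (X x) ('D_(Z x) Y x) v Ax.
have := T_alt23 (X x) ('D_(Z x) Y x) v Ax.
derive_lra.
Qed.
End ThreeForm.

(* Applied to the real part [T] and the imaginary part [T'] of a (3,0)-form. *)
Lemma invariant3_endo X (J : V -> V -> V) (T T' : V -> V -> V -> V -> R) :
  trilinear_on T -> (forall b c d, smooth_on A (fun y => T y b c d)) ->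
  (forall y b, A y -> differentiable (fun y => J y b) y) ->
  (forall y b, A y -> 'D_(X y) (fun y => J y b) y =
                      'D_(J y b) X y - J y ('D_b X y)) ->
  (forall y b c d, A y -> T' y b c d = - T y (J y b) c d) ->
  invariant3 X T -> invariant3 X T'.
Proof.
move=> [l1 l2 l3] sT dJ LJ T'E LT x b c d Ax.
rewrite (eq_derive_in _ oA Ax (fun y Ay => T'E y b c d Ay)) !T'E//.
have dT a : differentiable (fun y => T y a c d) x.
  exact: smooth_on_differentiable.
have [dTJ DTJ] := derive_slot oA Ax (fun y Ay => l1 y c d Ay) dT (dJ x b Ax).
have -> : 'D_(X x) (fun y => - T y (J y b) c d) x =
    - 'D_(X x) (fun y => T y (J y b) c d) x.
  by apply: deriveN; exact: diff_derivable.
rewrite DTJ LJ//.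
have := LT x (J x b) c d Ax.
have lB u v : T x (u - v) c d = T x u c d - T x v c d.
  by rewrite addrC -scaleN1r (l1 x c d Ax) mulN1r addrC.
rewrite lB; derive_lra.
Qed.

End LieDerivatives.

(** * Killing fields in a chart *)

Section Gronwall.
Context {R : realType}.

(* [exp (- 2 m C t) * \sum_i p_i ^+ 2] is nonincreasing, where [m = #|I|]. *)
Lemma gronwall_eq0 (I : finType) (p p' : I -> R -> R) (C : R) :
  (forall i (t : R), 0 <= t <= 1 -> is_derive t 1 (p i) (p' i t)) ->
  (forall i (t : R), 0 <= t <= 1 -> `|p' i t| <= C * \sum_j `|p j t|) ->
  (forall i, p i 0 = 0) -> forall i, p i 1 = 0.
Proof.
move=> dp bp p0.
wlog C0 : C bp / 0 <= C => [W|].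
  apply: (W `|C|) => // i t t01; apply: le_trans (bp i t t01) _.
  by rewrite ler_wpM2r ?sumr_ge0 ?ler_norm.
pose u (t : R) := \sum_i p i t * p i t.
pose u' (t : R) := \sum_i (p i t * p' i t *+ 2).
pose D := 2 * #|I|%:R * C.
pose e (t : R) := expR (- (D * t)).
have du (t : R) : 0 <= t <= 1 -> is_derive t 1 u (u' t).
  move=> t01.
  have H : is_derive t 1 (\sum_(i < #|I|) (fun t => p (enum_val i) t * p (enum_val i) t))
      (\sum_(i < #|I|) (p (enum_val i) t * p' (enum_val i) t *+ 2)).
    apply: is_derive_sum => i.
    have di := dp (enum_val i) t t01.
    exact: is_derive_eq (is_deriveM di di) _.
  rewrite [u](_ : _ = \sum_(i < #|I|) (fun t => p (enum_val i) t * p (enum_val i) t)).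
    rewrite [u' t](_ : _ = \sum_(i < #|I|) (p (enum_val i) t * p' (enum_val i) t *+ 2))//.
    by rewrite /u' (reindex (@enum_val _ I)) //; exact/onW_bij/enum_val_bij.
  apply/funext => s; rewrite fct_sumE /u.
  by rewrite (reindex (@enum_val _ I)) //; exact/onW_bij/enum_val_bij.
have de (t : R) : is_derive t 1 e (- D * e t).
  have dl : is_derive t 1 (fun t : R => - (D * t)) (- D).
    have := is_deriveN (is_deriveZ D (is_derive_id t (1 : R))).
    by rewrite /GRing.scale /= mulr1.
  have := @is_derive1_comp R expR (fun t => - (D * t)) t _ _ (is_derive_expR _) dl.
  by rewrite mulrC.
pose v (t : R) := u t * e t.
have dv (t : R) : 0 <= t <= 1 -> is_derive t 1 v ((u' t - D * u t) * e t).
  move=> t01; have := is_deriveM (du t t01) (de t).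
  by rewrite /GRing.scale /= (_ : _ + _ = (u' t - D * u t) * e t)//; ring.
have u'le t : 0 <= t <= 1 -> u' t <= D * u t.
  move=> t01; rewrite /u' /u /D.
  have sq (a b : R) : `|a| * `|b| *+ 2 <= a * a + b * b.
    have := sqr_ge0 (`|a| - `|b|).
    by rewrite sqrrB !real_normK ?num_real// !expr2; lra.
  have H i : p i t * p' i t *+ 2 <= \sum_j C * (p i t * p i t + p j t * p j t).
    apply: (@le_trans _ _ (`|p i t| * (C * \sum_j `|p j t|) *+ 2)).
      rewrite lerMn2r/=; apply: le_trans (ler_norm _) _.
      by rewrite normrM ler_wpM2l// bp.
    rewrite mulrCA -mulrnAr mulr_sumr -sumrMnl mulr_sumr; apply: ler_sum => j _.
    by rewrite ler_wpM2l.
  apply: (le_trans (ler_sum _ (fun i _ => H i))).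
  under eq_bigr do rewrite -mulr_sumr big_split /= sumr_const.
  rewrite -mulr_sumr big_split /= sumr_const sumrMnl -mulr_natl.
  by rewrite le_eqVlt; apply/orP; left; apply/eqP; ring.
have cv : {within `[0, 1], continuous v}.
  apply: derivable_within_continuous => s; rewrite in_itv/= => s01.
  by have [] := dv s s01.
have v10 : v 1 <= v 0.
  apply: (@ler0_derive1_le_cc _ v 0 1) => //; rewrite ?in_itv /= ?lexx ?ler01//.
    move=> s; rewrite in_itv/= => /andP[s0 s1].
    by have [] := dv s _; rewrite // !ltW.
  move=> s; rewrite in_itv/= => /andP[s0 s1].
  have s01 : 0 <= s <= 1 by rewrite !ltW.
  have [_ Ds] := dv s s01; rewrite derive1E Ds.
  by rewrite pmulr_lle0 ?expR_gt0// subr_le0 u'le.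
have u1 : u 1 <= 0.
  have v0 : v 0 = 0.
    by rewrite /v /u big1 ?mul0r// => i _; rewrite p0 mul0r.
  by move: v10; rewrite v0 /v pmulr_lle0// expR_gt0.
move=> i; apply/eqP; rewrite -sqrf_eq0 expr2.
apply/eqP/le_anti; rewrite -expr2 sqr_ge0 andbT expr2.
apply: le_trans u1; rewrite /u (bigD1 i) //= lerDl sumr_ge0// => j _.
by rewrite -expr2 sqr_ge0.
Qed.

End Gronwall.

Section Controlled.
Context {R : realType} {n : nat}.
Notation V := 'rV[R]_n.
Variables (K : set V) (N : V -> R).
Hypothesis cptK : compact K.
Hypothesis N_ge0 : forall y, 0 <= N y.

Definition controlled (q : V -> R) : Prop :=
  exists C, forall y, K y -> `|q y| <= C * N y.

Lemma eq_controlled (q r : V -> R) :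
  (forall y, K y -> q y = r y) -> controlled q -> controlled r.
Proof. by move=> qr [C HC]; exists C => y Ky; rewrite -qr//; exact: HC. Qed.

Lemma controlledD (q r : V -> R) :
  controlled q -> controlled r -> controlled (fun y => q y + r y).
Proof.
move=> [C HC] [D HD]; exists (C + D) => y Ky.
by apply: le_trans (ler_normD _ _) _; rewrite mulrDl lerD ?HC ?HD.
Qed.

Lemma compact_continuous_bounded (h : V -> R) :
  (forall y, K y -> {for y, continuous h}) ->
  exists2 C, 0 <= C & forall y, K y -> `|h y| <= C.
Proof.
move=> ch.
have cK : compact (h @` K).
  apply: continuous_compact => //; apply: continuous_in_subspaceT => y.
  by rewrite inE => /ch.
have [M [_ HM]] := compact_bounded cK.
exists (`|M| + 1) => [|y Ky]; first by rewrite addr_ge0.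
apply: (HM (`|M| + 1)); last by exists y.
by apply: le_lt_trans (ler_norm _) _; rewrite ltrDl.
Qed.

Lemma controlledM (h q : V -> R) : (forall y, K y -> {for y, continuous h}) ->
  controlled q -> controlled (fun y => h y * q y).
Proof.
move=> /compact_continuous_bounded[B B0 HB] [C HC]; exists (B * C) => y Ky.
by rewrite normrM -mulrA ler_pM// ?HB ?HC.
Qed.

Lemma controlledZ (a : R) (q : V -> R) :
  controlled q -> controlled (fun y => a * q y).
Proof. by apply: controlledM => y _; exact: cst_continuous. Qed.

Lemma controlledN (q : V -> R) : controlled q -> controlled (fun y => - q y).
Proof. by move=> [C HC]; exists C => y Ky; rewrite normrN HC. Qed.

Lemma controlled_sum (I : Type) (r : seq I) (P : pred I) (q : I -> V -> R) :
  (forall i, P i -> controlled (q i)) ->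
  controlled (fun y => \sum_(i <- r | P i) q i y).
Proof.
move=> cq; rewrite (_ : (fun y => _) = \sum_(i <- r | P i) q i); last first.
  by apply/funext => y; rewrite fct_sumE.
elim/big_ind : _ => //; last exact: controlledD.
by exists 0 => y _; rewrite normr0 mul0r.
Qed.

Lemma controlled_slot m (phi : V -> 'rV[R]_m -> R) (B : V -> 'rV[R]_m) :
  (forall y, K y -> scalar (phi y)) ->
  (forall b y, K y -> differentiable (phi^~ b) y) ->
  (forall i, controlled (fun y => B y 0 i)) ->
  controlled (fun y => phi y (B y)).
Proof.
move=> phi_lin dphi cB.
apply: (@eq_controlled (fun y => \sum_i phi y (delta_mx 0 i) * B y 0 i)).
  move=> y Ky; rewrite (scalar_sum (phi_lin _ Ky) (B y)).
  by apply: eq_bigr => i _; rewrite mulrC.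
apply: controlled_sum => i _; apply: controlledM => // y Ky.
exact/differentiable_continuous/dphi.
Qed.

End Controlled.

Section SmoothMatrices.
Context {R : realType} {n : nat}.
Notation V := 'rV[R]_n.
Variable A : set V.
Hypothesis oA : open A.

Lemma bilin_scalar (G : 'M[R]_n) :
  (forall c, scalar (bilin G ^~ c)) /\ (forall b, scalar (bilin G b)).
Proof.
split=> c k u v; rewrite /bilin.
  by rewrite !mulmxDl -!scalemxAl !mxE.
by rewrite linearD linearZ/= mulmxDr -scalemxAr !mxE.
Qed.

Lemma bilinNl (G : 'M[R]_n) u v : bilin G (- u) v = - bilin G u v.
Proof. by rewrite /bilin !mulNmx mxE. Qed.

Lemma bilinNr (G : 'M[R]_n) u v : bilin G u (- v) = - bilin G u v.
Proof. by rewrite /bilin linearN mulmxN mxE. Qed.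

Lemma bilinZl (G : 'M[R]_n) k u v : bilin G (k *: u) v = k * bilin G u v.
Proof. by rewrite /bilin -!scalemxAl mxE. Qed.

Lemma bilinZr (G : 'M[R]_n) k u v : bilin G u (k *: v) = k * bilin G u v.
Proof. by rewrite /bilin linearZ /= -scalemxAr mxE. Qed.

Lemma bilinC (G : 'M[R]_n) u v : G^T = G -> bilin G u v = bilin G v u.
Proof.
move=> GT; rewrite /bilin; have -> : (u *m G *m v^T) 0 0 = (u *m G *m v^T)^T 0 0.
  by rewrite [RHS]mxE.
by rewrite !trmx_mul trmxK GT mulmxA.
Qed.

Lemma smooth_on_mulmx m p q (M : V -> 'M[R]_(m, p)) (M' : V -> 'M[R]_(p, q)) :
  (forall i j, smooth_on A (fun y => M y i j)) ->
  (forall i j, smooth_on A (fun y => M' y i j)) ->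
  forall i j, smooth_on A (fun y => (M y *m M' y) i j).
Proof.
move=> sM sM' i j; apply: (smooth_on_eq oA (f := fun y => \sum_k M y i k * M' y k j)).
  by move=> y _; rewrite mxE.
by apply: smooth_on_sum => // k _; exact: smooth_onM.
Qed.

Lemma smooth_on_bilin (G : V -> 'M[R]_n) u v :
  (forall i j, smooth_on A (fun y => G y i j)) ->
  smooth_on A (fun y => bilin (G y) u v).
Proof.
move=> sG; apply: (smooth_on_mulmx (M := fun y => u *m G y) (M' := fun=> v^T)) => i j.
  by apply: (smooth_on_mulmx (M := fun=> u) (M' := G)) => // k l; exact: smooth_on_cst.
exact: smooth_on_cst.
Qed.

Lemma smooth_on_det m (M : V -> 'M[R]_m) :
  (forall i j, smooth_on A (fun y => M y i j)) ->
  smooth_on A (fun y => \det (M y)).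
Proof.
move=> sM; apply: smooth_on_sum => // s _; apply: smooth_onM => //.
  exact: smooth_on_cst.
exact: smooth_on_prod.
Qed.

Lemma differentiable_invmx m (M : V -> 'M[R]_m) x i j :
  (forall i j, smooth_on A (fun y => M y i j)) ->
  (forall y, A y -> M y \in unitmx) -> A x ->
  differentiable (fun y => invmx (M y) i j) x.
Proof.
move=> sM uM Ax.
apply: (eq_differentiable_in oA Ax (f := fun y => (\det (M y))^-1 * cofactor (M y) j i)).
  by move=> y Ay; rewrite /invmx uM// !mxE.
apply: differentiableM.
  apply: differentiableV; first exact: smooth_on_differentiable (smooth_on_det sM) Ax.
  by have := uM _ Ax; rewrite unitmxE unitfE.
apply: smooth_on_differentiable Ax; rewrite /cofactor.
apply: smooth_onM => //; first exact: smooth_on_cst.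
apply: smooth_on_det => k l.
by apply: (smooth_on_eq oA (f := fun y => M y (lift j k) (lift i l))) => // y _; rewrite !mxE.
Qed.

End SmoothMatrices.

(* A Killing field satisfies a second order equation that expresses its second
   derivatives linearly in its 1-jet; only the resulting bound on a compact set
   is needed. *)
Section KillingProlongation.
Context {R : realType} {n : nat}.
Notation V := 'rV[R]_n.
Notation e_ i := (delta_mx 0 i : 'rV[R]_n).
Variables (A K : set V) (G : V -> 'M[R]_n) (X : V -> V).
Hypotheses (oA : open A) (cptK : compact K) (KA : K `<=` A).
Hypothesis G_smooth : forall i j, smooth_on A (fun y => G y i j).
Hypothesis G_sym : forall y, A y -> (G y)^T = G y.
Hypothesis G_unit : forall y, A y -> G y \in unitmx.
Hypothesis X_smooth : smooth_on A X.
Let g y u v := bilin (G y) u v.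
Hypothesis X_killing : invariant2 A X g.

Definition jet1 (i : option 'I_n * 'I_n) (y : V) : R :=
  (if i.1 is Some a then 'D_(e_ a) X y else X y) 0 i.2.

Let N y := \sum_i `|jet1 i y|.

Let N_ge0 y : 0 <= N y. Proof. by apply: sumr_ge0. Qed.

Let controlled_jet1 i : controlled K N (jet1 i).
Proof.
exists 1 => y _; rewrite mul1r /N (bigD1 i)//= lerDl.
by apply: sumr_ge0.
Qed.

Let controlled_derive b k : controlled K N (fun y => ('D_b X y) 0 k).
Proof.
apply: (@eq_controlled _ _ _ _ (fun y => \sum_a b 0 a * jet1 (Some a, k) y)).
  move=> y /KA Ay; rewrite derive_sum_coord; last exact: smooth_on_differentiable Ay.
  by rewrite summxE; apply: eq_bigr => a _; rewrite mxE.
by apply: controlled_sum => a _; exact: controlledZ.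
Qed.

Let g_lin : bilinear_on A g.
Proof. by split=> y b _; [exact: (bilin_scalar _).1|exact: (bilin_scalar _).2]. Qed.

Let g_smooth b c : smooth_on A (fun y => g y b c).
Proof. exact: smooth_on_bilin. Qed.

Let dg b c y : A y -> differentiable (fun y => g y b c) y.
Proof. exact/smooth_on_differentiable/g_smooth. Qed.

Let controlled_sym p q r : controlled K N
  (fun y => g y ('D_p (fun z => 'D_q X z) y) r
            + g y q ('D_p (fun z => 'D_r X z) y)).
Proof.
have ctrl phi := @controlled_slot R n K N cptK n phi.
have sD u v : smooth_on A (fun y => 'D_p (fun z => g z u v) y).
  exact: smooth_on_derive.
apply: (@eq_controlled _ _ _ _ (fun y =>
   - ('D_(X y) (fun y => 'D_p (fun y => g y q r) y) y
     + 'D_('D_p X y) (fun z => g z q r) y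
     + 'D_p (fun z => g z ('D_q X y) r) y
     + 'D_p (fun z => g z q ('D_r X y)) y))).
  move=> y /KA Ay.
  have := derive_invariant2 oA p q r X_smooth g_lin g_smooth X_killing Ay.
  move=> ->; derive_lra.
apply: controlledN; apply: controlledD; [apply: controlledD; [apply: controlledD|]|].
- apply: (ctrl (fun y u => 'D_u (fun y => 'D_p (fun z => g z q r) y) y)).
  + by move=> y /KA Ay k u v; apply: derive_dirP; exact: smooth_on_differentiable Ay.
  + move=> b y /KA Ay; apply: smooth_on_differentiable Ay.
    exact: smooth_on_derive.
  + by move=> i; exact: (controlled_jet1 (None, i)).
- apply: (ctrl (fun y u => 'D_u (fun z => g z q r) y)) => //.
  + by move=> y /KA Ay k u v; apply: derive_dirP; exact: dg.
  + move=> b y /KA Ay; apply: smooth_on_differentiable Ay.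
    exact: smooth_on_derive.
- apply: (ctrl (fun y u => 'D_p (fun z => g z u r) y)) => //.
  + move=> y /KA Ay k u v; apply: derive_comb; [|exact: dg|exact: dg] => z.
    exact: (bilin_scalar _).1.
  + by move=> b y /KA; exact: smooth_on_differentiable.
- apply: (ctrl (fun y u => 'D_p (fun z => g z q u) y)) => //.
  + move=> y /KA Ay k u v; apply: derive_comb; [|exact: dg|exact: dg] => z.
    exact: (bilin_scalar _).2.
  + by move=> b y /KA; exact: smooth_on_differentiable.
Qed.

(* The same cyclic permutation as in the Koszul formula expresses
   [g (D_p D_q X, r)] through the symmetrized expressions. *)
Let controlled_hess p q r :
  controlled K N (fun y => g y ('D_p (fun z => 'D_q X z) y) r).
Proof.
have S := controlled_sym p q r; have S' := controlled_sym q p r.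
have S'' := controlledN (controlled_sym r q p).
apply: (eq_controlled _ (controlledZ cptK 2^-1 (controlledD (controlledD S S') S''))).
move=> y /KA Ay.
have gC u v : g y u v = g y v u.
  exact: bilinC (G_sym Ay).
have C s t := derive_comm_vec oA s t Ay X_smooth.
have := congr1 (g y ^~ r) (C q p); have := congr1 (g y q) (C r p).
have := congr1 (g y ^~ p) (C r q).
have := gC p ('D_q (fun z => 'D_r X z) y).
derive_lra.
Qed.

Lemma controlled_second_derivative p q k :
  controlled K N (fun y => ('D_p (fun z => 'D_q X z) y) 0 k).
Proof.
apply: (@eq_controlled _ _ _ _ (fun y => \sum_d
   invmx (G y) d k * g y ('D_p (fun z => 'D_q X z) y) (e_ d))).
  move=> y /KA Ay; set W := 'D_p _ y.
  rewrite -[in RHS](mulmxK (G_unit Ay) W) mxE; apply: eq_bigr => d _.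
  by rewrite mulrC /g /bilin trmx_delta -colE mxE.
apply: controlled_sum => d _; apply: controlledM => // y /KA Ay.
exact/differentiable_continuous/(differentiable_invmx oA).
Qed.

Lemma killing_compact_bound : exists C, forall y, K y -> forall i j,
  `|('D_(e_ j) (jet1 i) y)| <= C * N y.
Proof.
have H i j : controlled K N (fun y => 'D_(e_ j) (jet1 i) y).
  case: i => -[a|] k.
    apply: eq_controlled (controlled_second_derivative (e_ j) (e_ a) k) => y /KA Ay.
    rewrite derive_entry//; apply: smooth_on_differentiable Ay.
    exact: smooth_on_derive.
  apply: eq_controlled (controlled_derive (e_ j) k) => y /KA Ay.
  by rewrite derive_entry//; exact: smooth_on_differentiable Ay.
pose C i j := sval (cid (H i j)).
exists (\sum_i \sum_j `|C i j|) => y Ky i j.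
apply: le_trans (svalP (cid (H i j)) y Ky) _; apply: ler_wpM2r => //.
apply: le_trans (ler_norm _) _; rewrite (bigD1 i)//= (bigD1 j)//= -addrA lerDl.
by rewrite addr_ge0// ?sumr_ge0// => *; rewrite sumr_ge0.
Qed.

End KillingProlongation.

Section KillingSegment.
Context {R : realType} {n : nat}.
Notation V := 'rV[R]_n.
Variables (A : set V) (G : V -> 'M[R]_n) (X : V -> V).
Hypotheses (oA : open A).
Hypothesis G_smooth : forall i j, smooth_on A (fun y => G y i j).
Hypothesis G_sym : forall y, A y -> (G y)^T = G y.
Hypothesis G_unit : forall y, A y -> G y \in unitmx.
Hypothesis X_smooth : smooth_on A X.
Hypothesis X_killing : invariant2 A X (fun y u v => bilin (G y) u v).

Lemma killing_eq0_segment (y v : V) : (forall t : R, 0 <= t <= 1 -> A (y + t *: v)) ->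
  X y = 0 -> (forall b, 'D_b X y = 0) -> X (y + v) = 0.
Proof.
move=> seg X0 DX0.
pose gamma (t : R) : V := y + t *: v.
have cptK : compact (gamma @` [set` `[(0 : R), 1]]).
  apply: continuous_compact; last exact: segment_compact.
  apply: continuous_subspaceT => t; apply: differentiable_continuous.
  by apply: differentiableD; [exact: differentiable_cst|exact: differentiableZl].
have KA : (gamma @` [set` `[(0 : R), 1]]) `<=` A.
  by move=> _ [t + <-]; rewrite /= in_itv/= => t01; exact: seg.
have [C HC] := killing_compact_bound oA cptK KA G_smooth G_sym G_unit X_smooth X_killing.
have djet i t : 0 <= t <= 1 -> differentiable (jet1 X i) (gamma t).
  move=> t01; rewrite /jet1; case: i => -[a|] k /=; apply: differentiable_entry.
    apply: smooth_on_differentiable (seg t t01).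
    exact: smooth_on_derive.
  exact: smooth_on_differentiable (seg t t01).
have Dle i t : 0 <= t <= 1 -> `|'D_v (jet1 X i) (gamma t)| <=
    ((\sum_j `|v 0 j|) * C) * \sum_j `|jet1 X j (gamma t)|.
  move=> t01; rewrite derive_sum_coord; last exact: djet.
  apply: le_trans (ler_norm_sum _ _ _) _.
  rewrite -mulrA mulr_suml; apply: ler_sum => j _.
  rewrite normrM ler_wpM2l//; apply: HC; exists t => //.
have jet0 i : jet1 X i (gamma 0) = 0.
  rewrite /gamma scale0r addr0 /jet1; case: i => -[a|] k /=.
    by rewrite DX0 mxE.
  by rewrite X0 mxE.
have jet10 := gronwall_eq0 (fun i t t01 => derive_line (djet i t t01)) Dle jet0.
by apply/rowP => k; have := jet10 (None, k); rewrite /jet1 /gamma scale1r mxE.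
Qed.

End KillingSegment.

Section ConstantCoefficients.
Context {R : realType} {n : nat}.
Notation V := 'rV[R]_n.
Variable A : set V.
Hypothesis oA : open A.

Lemma open_ball_sub (q : V) : A q ->
  exists2 r : R, 0 < r & forall v, `|v| < r -> A (q + v).
Proof.
move=> Aq; have : \forall y \near q, A y by exact: open_nbhs_nbhs.
move=> /nbhs_normP[r r0 Hr]; exists r => // v vr; apply: Hr.
by rewrite /ball_ /= opprD addNKr normrN.
Qed.

Lemma derive0_locally_constant (a : V -> R) (q : V) : A q ->
  (forall y, A y -> differentiable a y) ->
  (forall y v, A y -> 'D_v a y = 0) ->
  exists2 r : R, 0 < r & forall v, `|v| < r -> A (q + v) /\ a (q + v) = a q.
Proof.
move=> Aq da Da; have [r r0 Hr] := open_ball_sub Aq; exists r => // v vr.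
split; first exact: Hr.
have seg (t : R) : 0 <= t <= 1 -> A (q + t *: v).
  move=> /andP[t0 t1]; apply: Hr; rewrite normrZ ger0_norm//.
  by apply: le_lt_trans vr; rewrite ler_piMl.
have H (i : unit) (t : R) : 0 <= t <= 1 ->
    is_derive t 1 (fun t : R => a (q + t *: v) - a q) 0.
  move=> t01; rewrite -[X in is_derive _ _ _ X](subr0 (0 : R)).
  apply: is_deriveB; rewrite -(Da _ v (seg t t01)); apply: derive_line.
  exact/da/seg.
have := @gronwall_eq0 R unit (fun _ t => a (q + t *: v) - a q) (fun _ _ => 0) 0 H.
move=> /(_ _ _ tt); rewrite scale1r => K; apply/eqP; rewrite -subr_eq0; apply/eqP.
apply: K => [i t _|_]; first by rewrite normr0 mul0r.
by rewrite scale0r addr0 subrr.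
Qed.

Lemma derive_dir2 (W : normedModType R) (f : V -> W) x (a b : R) u v :
  differentiable f x -> 'D_(a *: u + b *: v) f x = a *: 'D_u f x + b *: 'D_v f x.
Proof. by move=> df; rewrite !deriveE// linearP linearZ. Qed.

Lemma is_derive_scale m (a : V -> R) (X : V -> 'rV[R]_m) x v :
  differentiable a x -> differentiable X x ->
  is_derive x v (fun y => a y *: X y) ('D_v a x *: X x + a x *: 'D_v X x).
Proof.
move=> da dX.
have da' : derivable a x v by exact: diff_derivable.
have dX' i j : derivable (fun y => X y i j) x v.
  exact/diff_derivable/differentiable_entry.
have E i j : (fun y => (a y *: X y) i j) = a * (fun y => X y i j).
  by apply/funext => y; rewrite mxE.
have dZ : derivable (fun y => a y *: X y) x v.
  apply/derivable_mxP => i j.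
  exact: (eq_ind_r (fun h => derivable h x v) (derivableM da' (dX' i j)) (E i j)).
split=> //; apply/matrixP => i j.
apply: etrans (congr1 (fun M : 'rV_m => M i j) (derive_mx dZ)) _.
apply: etrans (mxE _ _ _ _) _.
apply: etrans (congr1 (fun h => 'D_v h x) (E i j)) _.
apply: etrans (deriveM da' (dX' i j)) _.
rewrite -(derive_entry v i j dX) addrC [RHS]mxE; congr (_ + _).
  by rewrite [RHS]mxE mulrC.
by rewrite [RHS]mxE.
Qed.

Let cramer0 (p q r s t : R) : p * r - q * q != 0 ->
  s * p + t * q = 0 -> s * q + t * r = 0 -> s = 0 /\ t = 0.
Proof.
move=> D0 e1 e2.
have s0 : s * (p * r - q * q) = 0.
  have -> : s * (p * r - q * q) = r * (s * p + t * q) - q * (s * q + t * r) by ring.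
  by rewrite e1 e2; ring.
have t0 : t * (p * r - q * q) = 0.
  have -> : t * (p * r - q * q) = p * (s * q + t * r) - q * (s * p + t * q) by ring.
  by rewrite e1 e2; ring.
by split; apply/eqP; [move/eqP: s0|move/eqP: t0]; rewrite mulf_eq0 (negbTE D0) orbF.
Qed.

Section Killing.
Variable g : V -> V -> V -> R.
Hypothesis g_lin : bilinear_on A g.
Hypothesis g_sym : forall y u v, A y -> g y u v = g y v u.
Hypothesis dg : forall b c y, A y -> differentiable (fun y => g y b c) y.

Lemma bilinear_on0 y w : A y -> g y 0 w = 0 /\ g y w 0 = 0.
Proof.
move=> Ay; have := g_lin.1 y w Ay 1 0 0; have := g_lin.2 y w Ay 1 0 0.
by rewrite scaler0 addr0 => ? ?; split; lra.
Qed.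

Lemma bilinear_on_comb y (k l : R) u v w : A y ->
  g y (k *: u + l *: v) w = k * g y u w + l * g y v w /\
  g y w (k *: u + l *: v) = k * g y w u + l * g y w v.
Proof.
move=> Ay; have [l1 l2] := g_lin; have [z1 z2] := bilinear_on0 w Ay.
rewrite (l1 y w Ay) (l2 y w Ay) -[l *: v]addr0 (l1 y w Ay) (l2 y w Ay).
by rewrite z1 z2 !addr0.
Qed.

(* The Killing equation gives da . X + db . Y = 0 (symmetric product), and
   commutation shows that da and db vanish on X and Y. *)
Lemma killing_comb_constant (X Y Z : V -> V) (a b : V -> R) y v : A y ->
  differentiable X y -> differentiable Y y ->
  differentiable a y -> differentiable b y ->
  invariant2 A X g -> invariant2 A Y g -> invariant2 A Z g ->
  commute_on A X Y -> commute_on A X Z -> commute_on A Y Z ->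
  (forall z, A z -> Z z = a z *: X z + b z *: Y z) ->
  g y (X y) (X y) * g y (Y y) (Y y) - g y (X y) (Y y) * g y (X y) (Y y) != 0 ->
  'D_v a y = 0 /\ 'D_v b y = 0.
Proof.
move=> Ay dX dY da db LX LY LZ cXY cXZ cYZ ZE gram.
have DZ u : 'D_u Z y = ('D_u a y *: X y + 'D_u b y *: Y y)
    + (a y *: 'D_u X y + b y *: 'D_u Y y).
  rewrite (eq_derive_in u oA Ay ZE).
  have [_ ->] := is_deriveD (is_derive_scale u da dX) (is_derive_scale u db dY).
  by rewrite addrACA.
have indep s t : s *: X y + t *: Y y = 0 -> s = 0 /\ t = 0.
  move=> st0; apply: (cramer0 gram).
    have := (bilinear_on_comb s t (X y) (Y y) (X y) Ay).2.
    by rewrite st0 (bilinear_on0 _ Ay).2.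
  have := (bilinear_on_comb s t (X y) (Y y) (Y y) Ay).1.
  by rewrite st0 (bilinear_on0 _ Ay).1.
have eX : 'D_(X y) Z y = a y *: 'D_(X y) X y + b y *: 'D_(X y) Y y.
  apply: etrans (cXZ _ Ay) _.
  apply: etrans (congr1 (fun u => 'D_u X y) (ZE y Ay)) _.
  apply: etrans (derive_dir2 _ _ _ _ dX) _.
  exact: (@congr1 V V (fun u : V => a y *: 'D_(X y) X y + b y *: u) _ _ (esym (cXY _ Ay))).
have eY : 'D_(Y y) Z y = a y *: 'D_(Y y) X y + b y *: 'D_(Y y) Y y.
  apply: etrans (cYZ _ Ay) _.
  apply: etrans (congr1 (fun u => 'D_u Y y) (ZE y Ay)) _.
  apply: etrans (derive_dir2 _ _ _ _ dY) _.
  exact: (@congr1 V V (fun u : V => a y *: u + b y *: 'D_(Y y) Y y) _ _ (cXY _ Ay)).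
have [aX bX] : 'D_(X y) a y = 0 /\ 'D_(X y) b y = 0.
  apply: indep; apply: (addIr (a y *: 'D_(X y) X y + b y *: 'D_(X y) Y y)).
  by rewrite add0r; exact: etrans (esym (DZ _)) eX.
have [aY bY] : 'D_(Y y) a y = 0 /\ 'D_(Y y) b y = 0.
  apply: indep; apply: (addIr (a y *: 'D_(Y y) X y + b y *: 'D_(Y y) Y y)).
  by rewrite add0r; exact: etrans (esym (DZ _)) eY.
have key u w : 'D_u a y * g y (X y) w + 'D_u b y * g y (Y y) w
    + 'D_w a y * g y u (X y) + 'D_w b y * g y u (Y y) = 0.
  have := LZ y u w Ay; rewrite ZE// derive_dir2; last exact: dg.
  have gD p q r : g y (p + q) r = g y p r + g y q r /\ g y r (p + q) = g y r p + g y r q.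
    by have := bilinear_on_comb 1 1 p q r Ay; rewrite !scale1r !mul1r.
  rewrite !DZ (gD _ _ w).1 (gD _ _ u).2.
  rewrite !(fun k l p q r => (bilinear_on_comb k l p q r Ay).1).
  rewrite !(fun k l p q r => (bilinear_on_comb k l p q r Ay).2).
  have := congr1 (fun s => a y * s) (LX y u w Ay).
  have := congr1 (fun s => b y * s) (LY y u w Ay).
  rewrite !mulr0 !mulrDr /GRing.scale /=; derive_lra.
have := key v (X y); have := key v (Y y).
rewrite aX bX aY bY !mul0r !addr0 (g_sym (Y y) (X y) Ay) => k2 k1.
exact: (cramer0 gram).
Qed.

Lemma killing_scale_constant (X Z : V -> V) (a : V -> R) y v : A y ->
  differentiable X y -> differentiable a y ->
  invariant2 A X g -> invariant2 A Z g ->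
  (forall z, A z -> Z z = a z *: X z) ->
  g y (X y) (X y) != 0 -> 'D_v a y = 0.
Proof.
move=> Ay dX da LX LZ ZE gXX.
have DZ u : 'D_u Z y = 'D_u a y *: X y + a y *: 'D_u X y.
  rewrite (eq_derive_in u oA Ay ZE).
  by have [_ ->] := is_derive_scale u da dX.
have key u w : 'D_u a y * g y (X y) w + 'D_w a y * g y u (X y) = 0.
  have := LZ y u w Ay; rewrite ZE// -[a y *: X y]addr0 -{1}(scale0r (X y)).
  rewrite derive_dir2; last exact: dg.
  rewrite !DZ !(fun k l p q r => (bilinear_on_comb k l p q r Ay).1).
  rewrite !(fun k l p q r => (bilinear_on_comb k l p q r Ay).2).
  have := congr1 (fun s => a y * s) (LX y u w Ay).
  rewrite !mulr0 !mulrDr scale0r addr0 /GRing.scale /=; derive_lra.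
have aX : 'D_(X y) a y = 0.
  have /eqP := key (X y) (X y); rewrite -mulrDl mulf_eq0 (negbTE gXX) orbF.
  by rewrite -mulr2n mulrn_eq0 => /eqP.
have /eqP := key v (X y); rewrite aX mul0r addr0 mulf_eq0 (negbTE gXX) orbF.
by move=> /eqP.
Qed.

End Killing.

Lemma open_neq0 (h : V -> R) : (forall y, A y -> differentiable h y) ->
  open [set y | A y /\ h y != 0].
Proof.
move=> dh; rewrite openE => y [Ay hy]; apply: filterI.
  exact: open_nbhs_nbhs.
exact: (cvgr_neq0 _ (differentiable_continuous (dh y Ay)) hy).
Qed.

End ConstantCoefficients.

(** * Linear algebra *)

Section PositiveDefinite.
Context {R : realType} {n : nat}.

Lemma bilin_add (G H : 'M[R]_n) (s t : R) u v :
  bilin (s *: G + t *: H) u v = s * bilin G u v + t * bilin H u v.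
Proof.
by rewrite /bilin mulmxDr mulmxDl -!scalemxAr -!scalemxAl !mxE.
Qed.

Lemma posdef_unitmx (G : 'M[R]_n) :
  (forall v : 'rV_n, v != 0 -> 0 < bilin G v v) -> G \in unitmx.
Proof.
move=> pG; rewrite unitmxE unitfE; apply/det0P => -[v v0 vG].
by have := pG v v0; rewrite /bilin vG mul0mx mxE ltxx.
Qed.

(* [det] does not vanish on the segment from the identity to [G]. *)
Lemma posdef_det_gt0 (G : 'M[R]_n) :
  (forall v : 'rV_n, v != 0 -> 0 < bilin G v v) -> 0 < \det G.
Proof.
move=> pG; rewrite lt_neqAle eq_sym.
have := posdef_unitmx pG; rewrite unitmxE unitfE => -> /=.
rewrite leNgt; apply/negP => dG.
pose M : 'M[{poly R}]_n :=
  (1 - 'X) *: (1%:M)%R + 'X *: map_mx polyC G.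
have ME (t : R) : (\det M).[t] = \det ((1 - t) *: 1%:M + t *: G).
  rewrite -horner_evalE -det_map_mx; congr (\det _); apply/matrixP => i j.
  by rewrite !mxE /= /horner_eval; case: eqP => _; rewrite !hornerE.
have [||t t01 tM] := @poly_ivt _ (- \det M) 0 1; first exact: ler01.
  rewrite !hornerN !ME subr0 scale1r scale0r addr0 det1 subrr scale0r add0r scale1r.
  by rewrite oppr_le0 ler01 oppr_ge0 ltW.
move: tM; rewrite /root hornerN oppr_eq0 ME => /det0P[v v0 vM].
have : 0 < bilin ((1 - t) *: 1%:M + t *: G) v v.
  rewrite bilin_add; move: t01 => /andP[t0 t1].
  have v1 : 0 < bilin 1%:M v v.
    rewrite /bilin mulmx1 mxE; under eq_bigr do rewrite mxE -expr2.
    rewrite lt_neqAle sumr_ge0 ?andbT => [|i _]; last exact: sqr_ge0.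
    apply: contra v0 => /eqP/esym/eqP; rewrite psumr_eq0 => [|i _]; last exact: sqr_ge0.
    move=> /allP v_0; apply/eqP/rowP => i; rewrite mxE; apply/eqP.
    by have := v_0 i (mem_index_enum _); rewrite sqrf_eq0.
  have vG := pG v v0.
  have [t_0|t_0] := eqVneq t 0; first by rewrite t_0 mul0r addr0 subr0 mul1r.
  apply: ltr_wpDl; first by apply: mulr_ge0; [rewrite subr_ge0|exact: ltW].
  by rewrite mulr_gt0// lt_neqAle eq_sym t_0.
by rewrite /bilin vM mul0mx mxE ltxx.
Qed.

End PositiveDefinite.

Section PermutationSums.
Context {R : comRingType}.

Lemma sum_perm_lift n (F : 'S_n.+1 -> R) :
  \sum_(s : 'S_n.+1) F s = \sum_j \sum_(t : 'S_n) F (lift_perm ord0 j t).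
Proof.
rewrite pair_big /= (reindex (fun jt : 'I_n.+1 * 'S_n => lift_perm ord0 jt.1 jt.2)) //.
apply/onW_bij/inj_card_bij; last by rewrite card_prod !card_Sn card_ord factS.
move=> [j t] [j' t'] /= E.
have jj' : j = j'.
  by have := congr1 (fun s : 'S_n.+1 => s ord0) E; rewrite /= !lift_perm_id.
move: E; rewrite -jj' => E; congr pair; apply/permP => k.
have := congr1 (fun s : 'S_n.+1 => s (lift ord0 k)) E.
by rewrite /= !lift_perm_lift => /lift_inj.
Qed.

Lemma sum_perm0 (F : 'S_0 -> R) : \sum_(s : 'S_0) F s = F 1%g.
Proof.
rewrite (big_pred1 1%g)// => s; apply/esym/eqP/permP; case=> //.
Qed.

End PermutationSums.

Section WedgeSquare.
Context {R : realType} {n : nat}.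
Notation V := 'rV[R]_n.

Lemma wedge_two_forms (h : V -> V -> R) (f : 'M[R]_(2, n) -> R)
    (M : 'M[R]_(2 + 2, n)) (r : nat -> V) :
  (forall w, f w = h (row 0 w) (row 1 w)) ->
  (forall a b, h a b = - h b a) ->
  (forall i, row i M = r (val i)) ->
  wedge f f M = 2 * (h (r 0%N) (r 1%N) * h (r 2%N) (r 3%N)
    - h (r 0%N) (r 2%N) * h (r 1%N) (r 3%N) + h (r 0%N) (r 3%N) * h (r 1%N) (r 2%N)).
Proof.
move=> fE hC rE.
have fu (s : 'S_(2 + 2)) : f (usubmx (row_perm s M)) = h (r (s 0)) (r (s (lift 0 0))).
  rewrite fE; congr h; rewrite -rE; apply/rowP => k; rewrite !mxE.
    by congr (M (s _) _); exact: val_inj.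
  by congr (M (s _) _); exact: val_inj.
have fd (s : 'S_(2 + 2)) : f (dsubmx (row_perm s M)) =
    h (r (s (lift 0 (lift 0 0)))) (r (s (lift 0 (lift 0 (lift 0 0))))).
  rewrite fE; congr h; rewrite -rE; apply/rowP => k; rewrite !mxE.
    by congr (M (s _) _); exact: val_inj.
  by congr (M (s _) _); exact: val_inj.
rewrite /wedge; under eq_bigr do rewrite fu fd.
pose F (b : bool) (i j k l : nat) := (-1) ^+ b * h (r i) (r j) * h (r k) (r l) : R.
rewrite (_ : \sum_(s : 'S_(2 + 2)) _ = \sum_(s : 'S_4)
  F s (s 0) (s (lift 0 0)) (s (lift 0 (lift 0 0)))
    (s (lift 0 (lift 0 (lift 0 0)))))//.
rewrite sum_perm_lift !big_ord_recl big_ord0 /=.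
rewrite !sum_perm_lift !big_ord_recl !big_ord0 /=.
rewrite !sum_perm_lift !big_ord_recl !big_ord0 /=.
rewrite !sum_perm_lift !big_ord_recl !big_ord0 /=.
rewrite !sum_perm0.
rewrite !odd_lift_perm !odd_perm1 !lift_perm_lift !lift_perm_id /=.
rewrite /bump /= /F /= !expr0 !expr1 (_ : (2`! * 2`!)%:R = 4 :> R)//.
rewrite (hC (r 1%N) (r 0%N)) (hC (r 2%N) (r 0%N)) (hC (r 3%N) (r 0%N)).
rewrite (hC (r 2%N) (r 1%N)) (hC (r 3%N) (r 1%N)) (hC (r 3%N) (r 2%N)).
by field.
Qed.

End WedgeSquare.

Section RowLists.
Context {R : realType} {n : nat}.
Notation V := 'rV[R]_n.

Definition rows3 (a b c : V) : 'M[R]_(3, n) := \matrix_(i < 3) [:: a; b; c]`_i.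

Lemma rows3K (M : 'M[R]_(3, n)) : M = rows3 (row 0 M) (row 1 M) (row 2 M).
Proof.
apply/row_matrixP => i; rewrite rowK.
by case: i => [[|[|[|//]]] i3] /=; congr row; exact: val_inj.
Qed.

Lemma row'_rows3 (a b c a' b' c' : V) (i : 'I_3) :
  (i != 0 -> a = a') -> (i != 1 -> b = b') -> (i != 2 -> c = c') ->
  row' i (rows3 a b c) = row' i (rows3 a' b' c').
Proof.
move=> ea eb ec; apply/matrixP => j k; rewrite !mxE.
have := neq_lift i j; rewrite eq_sym; set l := lift i j => li.
case: l li => [[|[|[|//]]] l3] li /=.
- by rewrite ea//; apply: contra li => /eqP ->; apply/eqP/val_inj.
- by rewrite eb//; apply: contra li => /eqP ->; apply/eqP/val_inj.
- by rewrite ec//; apply: contra li => /eqP ->; apply/eqP/val_inj.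
Qed.

Variable P : 'M[R]_(3, n) -> R.
Hypotheses (P_lin : multilinear_form P) (P_alt : alternating_form P).

Lemma form3_scalar :
  [/\ forall b c, scalar (fun a => P (rows3 a b c)),
      forall a c, scalar (fun b => P (rows3 a b c)) &
      forall a b, scalar (fun c => P (rows3 a b c))].
Proof.
have sub i u v w k : row i u = k *: row i v + row i w ->
    row' i v = row' i u -> row' i w = row' i u -> P u = k * P v + P w.
  by move=> ru rv rw; rewrite (P_lin (b := k) (c := 1) _ rv rw) ?mul1r// scale1r.
split=> b c k u v.
- by apply: (sub 0); rewrite ?rowK//; apply: row'_rows3.
- by apply: (sub 1); rewrite ?rowK//; apply: row'_rows3.
- by apply: (sub 2); rewrite ?rowK//; apply: row'_rows3.
Qed.

Lemma form3_alt a b :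
  [/\ P (rows3 a a b) = 0, P (rows3 b a a) = 0 & P (rows3 a b a) = 0].
Proof.
split.
- by apply: (P_alt (a := 0) (b := 1)) => //; rewrite !rowK.
- by apply: (P_alt (a := 1) (b := 2)) => //; rewrite !rowK.
- by apply: (P_alt (a := 0) (b := 2)) => //; rewrite !rowK.
Qed.

Lemma form3_antisym a b c :
  P (rows3 a b c) = - P (rows3 b a c) /\ P (rows3 a b c) = - P (rows3 a c b).
Proof.
have [l1 l2 l3] := form3_scalar; split.
  have [z _ _] := form3_alt (a + b) c; move: z.
  have := l1 (a + b) c 1 a b; rewrite scale1r => ->.
  have := l2 a c 1 a b; rewrite scale1r => ->.
  have := l2 b c 1 a b; rewrite scale1r => ->.
  by have [-> _ _] := form3_alt a c; have [-> _ _] := form3_alt b c; lra.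
have [_ z _] := form3_alt (b + c) a; move: z.
have := l2 a (b + c) 1 b c; rewrite scale1r => ->.
have := l3 a b 1 b c; rewrite scale1r => ->.
have := l3 a c 1 b c; rewrite scale1r => ->.
by have [_ -> _] := form3_alt b a; have [_ -> _] := form3_alt c a; lra.
Qed.

End RowLists.

Section ComplexThreeForms.
Context {R : realType}.
Notation V := 'rV[R]_6.
Variables (J : 'M[R]_6) (P Q : 'M[R]_(3, 6) -> R).
Hypothesis JJ : J *m J = - 1%:M.
Hypotheses (P_lin : multilinear_form P) (P_alt : alternating_form P).
Hypotheses (Q_lin : multilinear_form Q) (Q_alt : alternating_form Q).
Hypothesis PQ_type30 : forall (v w : 'M[R]_(3, 6)) (a : 'I_3),
  row a w = row a v *m J -> row' a w = row' a v ->
  (P w +i* Q w)%C = 'i%C * (P v +i* Q v)%C.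

Let JK (u : V) : u *m J *m J = - u.
Proof. by rewrite -mulmxA JJ mulmxN mulmx1. Qed.

Lemma type30_rows3 a b c :
  [/\ P (rows3 (a *m J) b c) = - Q (rows3 a b c) /\
        Q (rows3 (a *m J) b c) = P (rows3 a b c),
      P (rows3 a (b *m J) c) = - Q (rows3 a b c) /\
        Q (rows3 a (b *m J) c) = P (rows3 a b c) &
      P (rows3 a b (c *m J)) = - Q (rows3 a b c) /\
        Q (rows3 a b (c *m J)) = P (rows3 a b c)].
Proof.
have sub v w i : row i w = row i v *m J -> row' i w = row' i v ->
    P w = - Q v /\ Q w = P v.
  move=> rw rv; have := PQ_type30 rw rv; rewrite /GRing.mul /=.
  by rewrite !mul0r !mul1r sub0r add0r => -[].
split.
- by apply: (sub _ _ 0); rewrite ?rowK//; apply: row'_rows3.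
- by apply: (sub _ _ 1); rewrite ?rowK//; apply: row'_rows3.
- by apply: (sub _ _ 2); rewrite ?rowK//; apply: row'_rows3.
Qed.

Lemma type30_coef (phi chi : V -> R) (u v w : V) (a b c d e f : R) :
  scalar phi -> scalar chi ->
  (forall x, phi (x *m J) = - chi x /\ chi (x *m J) = phi x) ->
  phi v = 0 -> chi v = 0 -> phi w = 0 -> chi w = 0 -> chi u != 0 ->
  a *: u + b *: v + c *: w + d *: (u *m J) + e *: (v *m J) + f *: (w *m J) = 0 ->
  a = 0 /\ d = 0.
Proof.
move=> lp lc HJ pv cv pw cw cu S.
have ev (h : V -> R) : scalar h -> a * h u + b * h v + c * h w + d * h (u *m J)
    + e * h (v *m J) + f * h (w *m J) = 0.
  move=> lh; have h0 : h 0 = 0 by have := lh 1 0 0; rewrite scaler0 addr0; lra.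
  have hD x y : h (x + y) = h x + h y by rewrite -[x]scale1r lh mul1r scale1r.
  have hZ k x : h (k *: x) = k * h x by rewrite -[k *: x]addr0 lh h0 addr0.
  by rewrite -[RHS]h0 -S !hD !hZ.
have e1 := ev _ lp; have e2 := ev _ lc.
have [pu' cu'] := HJ u; have [pv' cv'] := HJ v; have [pw' cw'] := HJ w.
rewrite pu' pv' pw' pv cv pw cw !(mulr0, oppr0, addr0) in e1.
rewrite cu' cv' cw' pv cv pw cw !(mulr0, oppr0, addr0) in e2.
have D0 : phi u ^+ 2 + chi u ^+ 2 != 0.
  by rewrite gt_eqF// ltr_wpDl ?sqr_ge0// lt_neqAle eq_sym sqrf_eq0 cu sqr_ge0.
have a0 : a * (phi u ^+ 2 + chi u ^+ 2) = 0.
  have -> : a * (phi u ^+ 2 + chi u ^+ 2) =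
    phi u * (a * phi u + d * - chi u) + chi u * (a * chi u + d * phi u) by ring.
  by rewrite e1 e2; ring.
have d0 : d * (phi u ^+ 2 + chi u ^+ 2) = 0.
  have -> : d * (phi u ^+ 2 + chi u ^+ 2) =
    phi u * (a * chi u + d * phi u) - chi u * (a * phi u + d * - chi u) by ring.
  by rewrite e1 e2; ring.
by move/eqP: a0; move/eqP: d0; rewrite !mulf_eq0 (negbTE D0) !orbF => /eqP-> /eqP->.
Qed.

Lemma type30_independent u1 u2 u3 (a b c d e f : R) : Q (rows3 u1 u2 u3) != 0 ->
  a *: u1 + b *: u2 + c *: u3 + d *: (u1 *m J) + e *: (u2 *m J) + f *: (u3 *m J) = 0 ->
  [/\ a = 0 /\ d = 0, b = 0 /\ e = 0 & c = 0 /\ f = 0].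
Proof.
move=> Q0 S; have [p1 p2 p3] := form3_scalar P_lin; have [q1 q2 q3] := form3_scalar Q_lin.
have J1 x := let: And3 h _ _ := type30_rows3 x u2 u3 in h.
have J2 x := let: And3 _ h _ := type30_rows3 u1 x u3 in h.
have J3 x := let: And3 _ _ h := type30_rows3 u1 u2 x in h.
have Pa u v := form3_alt P_alt u v; have Qa u v := form3_alt Q_alt u v.
have [] := (Pa u1 u2, Qa u1 u2) => -[P112 P211 P121] [Q112 Q211 Q121].
have [] := (Pa u1 u3, Qa u1 u3) => -[P113 P311 P131] [Q113 Q311 Q131].
have [] := (Pa u2 u3, Qa u2 u3) => -[P223 P322 P232] [Q223 Q322 Q232].
have [] := (Pa u3 u2, Qa u3 u2) => -[P332 P233 P323] [Q332 Q233 Q323].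
have [] := (Pa u3 u1, Qa u3 u1) => -[P331 P133 P313] [Q331 Q133 Q313].
have [] := (Pa u2 u1, Qa u2 u1) => -[P221 P122 P212] [Q221 Q122 Q212].
split.
- exact: (type30_coef (p1 u2 u3) (q1 u2 u3) J1 P223 Q223 P323 Q323 Q0 S).
- apply: (type30_coef (p2 u1 u3) (q2 u1 u3) J2 P113 Q113 P133 Q133 Q0
    (a := b) (b := a) (c := c) (d := e) (e := d) (f := f)).
  by rewrite -[RHS]S [RHS](ACl (2*1*3*5*4*6)).
- apply: (type30_coef (p3 u1 u2) (q3 u1 u2) J3 P121 Q121 P122 Q122 Q0
    (a := c) (b := a) (c := b) (d := f) (e := d) (f := e)).
  by rewrite -[RHS]S [RHS](ACl (3*1*2*6*4*5)).
Qed.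

Lemma type30_free u1 u2 u3 : Q (rows3 u1 u2 u3) != 0 ->
  free [:: u1; u2; u3; u1 *m J; u2 *m J; u3 *m J].
Proof.
move=> Q0.
apply/(@freeP _ _ 6 [tuple u1; u2; u3; u1 *m J; u2 *m J; u3 *m J]) => k.
rewrite !big_ord_recl big_ord0 addr0 /= !addrA => S.
have [[k0 k3] [k1 k4] [k2 k5]] := type30_independent Q0 S.
move=> [[|[|[|[|[|[|//]]]]]] i6].
- by rewrite -[RHS]k0; congr k; exact: val_inj.
- by rewrite -[RHS]k1; congr k; exact: val_inj.
- by rewrite -[RHS]k2; congr k; exact: val_inj.
- by rewrite -[RHS]k3; congr k; exact: val_inj.
- by rewrite -[RHS]k4; congr k; exact: val_inj.
- by rewrite -[RHS]k5; congr k; exact: val_inj.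
Qed.

Definition J_stable (s : seq V) := forall x, x \in span s -> x *m J \in span s.

Lemma J_stable_cons (s : seq V) w : J_stable s -> J_stable [:: w, w *m J & s].
Proof.
move=> Js x; rewrite !span_cons => /memv_addP[_ /vlineP[a ->] [y]].
move=> /memv_addP[_ /vlineP[b ->] [z /Js zJ ->] ->].
rewrite !mulmxDl -!scalemxAl JK scalerN addrCA.
rewrite -scaleNr memv_add// ?memvZ ?memv_line//.
by rewrite memv_add// memvZ// memv_line.
Qed.

Lemma J_free_cons (s : seq V) w : J_stable s -> free s -> w \notin span s ->
  free [:: w, w *m J & s].
Proof.
move=> Js fs ws; rewrite !free_cons fs andbT; apply/andP; split; last first.
  by apply: contra ws => /Js; rewrite JK memvN.
apply: contra ws; rewrite span_cons => /memv_addP[_ /vlineP[a ->] [z zs wE]].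
have wJE : w *m J = - (a *: w) + z *m J.
  by rewrite {1}wE mulmxDl -scalemxAl JK scalerN.
have : (1 + a ^+ 2) *: w \in span s.
  rewrite (_ : _ *: w = a *: (z *m J) + z).
    by rewrite memvD// memvZ// Js.
  rewrite scalerDl scale1r [X in X + _ = _]wE wJE scalerDr scalerN scalerA expr2.
  by rewrite addrC addrA [_ + (_ + _)]addrA subrr add0r.
have a1 : 1 + a ^+ 2 != 0 by rewrite gt_eqF// ltr_wpDr ?sqr_ge0.
by move=> H; rewrite -[w](scalerK a1) memvZ.
Qed.

Lemma exists_notin_span (s : seq V) : (size s < 6)%N -> exists w, w \notin span s.
Proof.
move=> s6; have : ~~ (fullv <= span s)%VS.
  apply: contraL s6 => /dimvS; rewrite dimvf /dim /= mul1n -leqNgt => h.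
  exact: leq_trans h (dim_span s).
by move=> /subvPn[w _ ws]; exists w.
Qed.

(* Otherwise [w, J w, v, J v, u, J u] is a basis for some [w], and
   [psi (u, v, .) = 0] makes [psi] vanish on all triples of its vectors, hence
   [psi /\ conj psi] vanish on the basis. *)
Lemma type30_degenerate (k : R) u v : k != 0 ->
  (forall M : 'M[R]_6,
     wedge (fun w : 'M[R]_(3, 6) => (P w +i* Q w)%C)
           (fun w : 'M[R]_(3, 6) => ((P w +i* Q w)^*)%C) M
     = - 8 * 'i%C * (k * \det M)%:C%C) ->
  u != 0 -> (forall x, P (rows3 u v x) = 0) -> exists a b, v = a *: u + b *: (u *m J).
Proof.
move=> k0 norm u0 Puv.
have [|vu] := boolP (v \in span [:: u; u *m J]).
  rewrite !span_cons span_nil addv0 => /memv_addP[_ /vlineP[a ->] [_ /vlineP[b ->] ->]].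
  by exists a, b.
have J0 : J_stable [::].
  by move=> x; rewrite span_nil !memv0 => /eqP ->; rewrite mul0mx.
have Ju := J_stable_cons (w := u) J0.
have fu : free [:: u; u *m J].
  by apply: J_free_cons => //; [exact: nil_free|rewrite span_nil memv0].
have fv := J_free_cons Ju fu vu.
have [w wv] := @exists_notin_span [:: v; v *m J; u; u *m J] isT.
have fw := J_free_cons (J_stable_cons (w := v) Ju) fv wv.
pose B := [:: w; w *m J; v; v *m J; u; u *m J].
pose M : 'M[R]_6 := \matrix_(i < 6) B`_i.
have dM : \det M != 0.
  apply/det0P => -[x x0]; rewrite mulmx_sum_row => xM.
  have /(_ (fun i => x 0 i)) H := (@freeP _ _ 6 [tuple of B] fw).
  move/eqP: x0; apply; apply/rowP => i; rewrite mxE; apply: H.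
  by rewrite -[RHS]xM; apply: eq_bigr => j _; rewrite rowK.
pose Z a b c := P (rows3 a b c) = 0 /\ Q (rows3 a b c) = 0.
have ZJ a b c : Z a b c -> [/\ Z (a *m J) b c, Z a (b *m J) c & Z a b (c *m J)].
  rewrite /Z => -[z1 z2]; have [[-> ->] [-> ->] [-> ->]] := type30_rows3 a b c.
  by rewrite z1 z2 oppr0.
have Zuv x : Z u v x.
  split; first exact: Puv.
  have [_ _ [E _]] := type30_rows3 u v x.
  by have := Puv (x *m J); rewrite E => /eqP; rewrite oppr_eq0 => /eqP.
have Z12 a b c : Z a b c -> Z b a c.
  rewrite /Z => -[]; rewrite (form3_antisym P_lin P_alt a b c).1.
  rewrite (form3_antisym Q_lin Q_alt a b c).1.
  by move=> /eqP + /eqP; rewrite !oppr_eq0 => /eqP ? /eqP.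
have Z23 a b c : Z a b c -> Z a c b.
  rewrite /Z => -[]; rewrite (form3_antisym P_lin P_alt a b c).2.
  rewrite (form3_antisym Q_lin Q_alt a b c).2.
  by move=> /eqP + /eqP; rewrite !oppr_eq0 => /eqP ? /eqP.
have Zaa a b : Z a a b.
  by split; [have [] := form3_alt P_alt a b|have [] := form3_alt Q_alt a b].
have base a b c : a \in [:: u; v; w] -> b \in [:: u; v; w] -> c \in [:: u; v; w] ->
    Z a b c.
  have Zvu x := Z12 _ _ _ (Zuv x).
  rewrite !inE => /or3P[]/eqP-> /or3P[]/eqP-> /or3P[]/eqP-> //;
    by [exact: Z23|apply: Z12; exact: Z23].
have BE b : b \in B -> exists2 x, x \in [:: u; v; w] & b = x \/ b = x *m J.
  rewrite !inE => /or4P[/eqP->|/eqP->|/eqP->|/or3P[/eqP->|/eqP->|/eqP->]].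
  - by exists w; [rewrite !inE eqxx !orbT|left].
  - by exists w; [rewrite !inE eqxx !orbT|right].
  - by exists v; [rewrite !inE eqxx !orbT|left].
  - by exists v; [rewrite !inE eqxx !orbT|right].
  - by exists u; [rewrite !inE eqxx|left].
  - by exists u; [rewrite !inE eqxx|right].
have ZB a b c : a \in B -> b \in B -> c \in B -> Z a b c.
  move=> /BE[a' a'B aE] /BE[b' b'B bE] /BE[c' c'B cE].
  have z := base _ _ _ a'B b'B c'B.
  have {}z : Z a b' c' by case: aE => ->; [exact: z|have [] := ZJ _ _ _ z].
  have {}z : Z a b c' by case: bE => ->; [exact: z|have [] := ZJ _ _ _ z].
  by case: cE => ->; [exact: z|have [] := ZJ _ _ _ z].
have := norm M; rewrite /wedge big1 => [|s _].
  rewrite mulr0 => /esym/eqP.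
  rewrite !mulf_eq0 oppr_eq0 pnatr_eq0 /=.
  rewrite eq_complex /= oner_eq0 andbF /= eq_complex /= eqxx andbT mulf_eq0.
  by rewrite (negbTE k0) (negbTE dM).
pose Ms := usubmx (row_perm s M : 'M[R]_(3 + 3, 6)).
have [z1 z2] : Z (row 0 Ms) (row 1 Ms) (row 2 Ms).
  have rB i : row i Ms \in B.
    rewrite (_ : row _ _ = B`_(s (lshift 3 i))); first exact: mem_nth.
    by apply/rowP => j; rewrite !mxE.
  exact: ZB.
by rewrite (rows3K (usubmx _)) -/Ms z1 z2 mulr0 mul0r.
Qed.

End ComplexThreeForms.

(** * Nearly Kaehler structures in a chart *)

(* [P], [Q] and [w] are the expressions of psi^+, psi^- and omega in the chart
   domain [A]; [dQ] is d psi^- = - 2 omega /\ omega with the wedge expanded. *)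
Section NearlyKaehlerChart.
Context {R : realType}.
Notation V := 'rV[R]_6.
Variables (A : set V) (G J : V -> 'M[R]_6) (P Q : V -> 'M[R]_(3, 6) -> R) (vol : V -> R).
Let g y u v := bilin (G y) u v.
Let w y u v := bilin (G y) (u *m J y) v.
Hypothesis oA : open A.
Hypothesis G_smooth : forall i j, smooth_on A (fun y => G y i j).
Hypothesis G_sym : forall y, A y -> (G y)^T = G y.
Hypothesis G_pos : forall y (v : V), A y -> v != 0 -> 0 < g y v v.
Hypothesis J_smooth : forall i j, smooth_on A (fun y => J y i j).
Hypothesis JJ : forall y, A y -> J y *m J y = - 1%:M.
Hypothesis J_orth : forall y u v, A y -> g y (u *m J y) (v *m J y) = g y u v.
Hypothesis P_lin : forall y, A y -> multilinear_form (P y).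
Hypothesis P_alt : forall y, A y -> alternating_form (P y).
Hypothesis Q_lin : forall y, A y -> multilinear_form (Q y).
Hypothesis Q_alt : forall y, A y -> alternating_form (Q y).
Hypothesis P_smooth : forall u, smooth_on A (fun y => P y u).
Hypothesis Q_smooth : forall u, smooth_on A (fun y => Q y u).
Hypothesis PQ_type30 : forall y (v w : 'M[R]_(3, 6)) (a : 'I_3), A y ->
  row a w = row a v *m J y -> row' a w = row' a v ->
  (P y w +i* Q y w)%C = 'i%C * (P y v +i* Q y v)%C.
Hypothesis PQ_norm : forall y (M : 'M[R]_6), A y ->
  wedge (fun w : 'M[R]_(3, 6) => (P y w +i* Q y w)%C)
        (fun w : 'M[R]_(3, 6) => ((P y w +i* Q y w)^*)%C) M
  = - 8 * 'i%C * (vol y * \det M)%:C%C.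
Hypothesis vol_neq0 : forall y, A y -> vol y != 0.
Hypothesis dw : forall y a b c, A y -> ext_d2 w y a b c = 3 * P y (rows3 a b c).
Hypothesis dQ : forall y a b c d, A y ->
  ext_d3 (fun y a b c => Q y (rows3 a b c)) y a b c d =
  - 2 * (2 * (w y a b * w y c d - w y a c * w y b d + w y a d * w y b c)).

Let gC y u v : A y -> g y u v = g y v u.
Proof. by move=> Ay; exact: bilinC (G_sym Ay). Qed.

Let g_lin : bilinear_on A g.
Proof. by split=> y b _; [exact: (bilin_scalar _).1|exact: (bilin_scalar _).2]. Qed.

Let g_smooth b c : smooth_on A (fun y => g y b c).
Proof. exact: smooth_on_bilin. Qed.

Let wE y b c : w y b c = bilin (J y *m G y) b c.
Proof. by rewrite /w /bilin mulmxA. Qed.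

Let w_lin : bilinear_on A w.
Proof.
split=> y b _ k u v; rewrite !wE; [exact: (bilin_scalar _).1|exact: (bilin_scalar _).2].
Qed.

Let w_smooth b c : smooth_on A (fun y => w y b c).
Proof.
apply: (smooth_on_eq oA (f := fun y => bilin (J y *m G y) b c)) => [y _|].
  by rewrite wE.
by apply: smooth_on_bilin => //; exact: smooth_on_mulmx.
Qed.

Let w_alt y b c : A y -> w y b c = - w y c b.
Proof.
move=> Ay; rewrite /w -[bilin _ _ c](J_orth _ c Ay) -mulmxA JJ// mulmxN mulmx1.
by rewrite /g bilinNl; congr (- _); exact: gC.
Qed.

Let w_diag y b : A y -> w y b b = 0.
Proof. by move=> Ay; have := w_alt b b Ay; lra. Qed.

Lemma chart_J_differentiable (b y : V) : A y -> differentiable (fun y => b *m J y) y.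
Proof.
move=> Ay; apply: differentiable_row => j.
have sb : smooth_on A (fun y => (b *m J y) 0 j).
  by apply: (smooth_on_mulmx oA (M := fun=> b)) => // k l; exact: smooth_on_cst.
exact: smooth_on_differentiable sb Ay.
Qed.

Let w_nondegenerate y u : A y -> (forall v, w y u v = 0) -> u = 0.
Proof.
move=> Ay u0; apply/eqP/negPn/negP => un0.
have := G_pos Ay un0; rewrite -J_orth// => pos.
by have := u0 (u *m J y); rewrite /w => E; move: pos; rewrite /g E ltxx.
Qed.

Record chart_symmetry (X : V -> V) : Prop := ChartSymmetry {
  cs_smooth : smooth_on A X;
  cs_killing : invariant2 A X g;
  cs_J : forall y b : V, A y ->
    'D_(X y) (fun y => b *m J y) y = 'D_(b *m J y) X y - 'D_b X y *m J y
}.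

Lemma chart_symmetry_omega X : chart_symmetry X -> invariant2 A X w.
Proof.
case=> sX KX JX x b c Ax.
have dg u : differentiable (fun y => g y u c) x.
  exact: smooth_on_differentiable (g_smooth u c) Ax.
have [_ D] := derive_slot oA Ax (phi := fun y u => g y u c)
  (fun y Ay => g_lin.1 y c Ay) dg (chart_J_differentiable b Ax).
have := KX x (b *m J x) c Ax.
have E : 'D_(X x) (fun y => w y b c) x = _ := D (X x).
rewrite E (JX _ _ Ax).
have -> p q : g x (p - q) c = g x p c - g x q c.
  by rewrite -[p]scale1r /g (bilin_scalar _).1 bilinNl mul1r scale1r.
rewrite /w /g; derive_lra.
Qed.

Let T y a b c := P y (rows3 a b c).
Let T' y a b c := Q y (rows3 a b c).

Let T_lin : trilinear_on A T.
Proof.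
by split=> y a b Ay; have [l1 l2 l3] := form3_scalar (P_lin Ay);
  first [exact: l1|exact: l2|exact: l3].
Qed.

Let T'_lin : trilinear_on A T'.
Proof.
by split=> y a b Ay; have [l1 l2 l3] := form3_scalar (Q_lin Ay);
  first [exact: l1|exact: l2|exact: l3].
Qed.

Lemma chart_symmetry_psip X : chart_symmetry X -> invariant3 A X T.
Proof.
move=> SX x b c d Ax.
have LX := chart_symmetry_omega SX.
have := ext_d2_invariant oA (cs_smooth SX) w_lin w_smooth w_alt LX b c d Ax.
rewrite !dw// (eq_derive_in _ oA Ax (fun y Ay => dw b c d Ay)).
have -> : 'D_(X x) (fun y => 3 * P y (rows3 b c d)) x = 3 * 'D_(X x) (fun y => T y b c d) x.
  apply: deriveZ; apply: diff_derivable.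
  exact: smooth_on_differentiable (P_smooth _) Ax.
rewrite /T; derive_lra.
Qed.

Lemma chart_symmetry_psim X : chart_symmetry X -> invariant3 A X T'.
Proof.
move=> SX.
apply: (invariant3_endo oA (J := fun y b => b *m J y) (T := T)) => //.
- by move=> b c d; exact: P_smooth.
- by move=> y b Ay; exact: chart_J_differentiable.
- by move=> y b Ay; exact: cs_J.
- move=> y b c d Ay; have [[E _] _ _] := type30_rows3 (fun v w a => @PQ_type30 y v w a Ay) b c d.
  by rewrite /T E opprK.
- exact: chart_symmetry_psip.
Qed.


Let gram_neq0 y u v : A y -> w y u v != 0 -> g y u u * g y v v - g y u v * g y u v != 0.
Proof.
move=> Ay; apply: contra => /eqP D0; apply/eqP.
pose n := g y u u *: v + (- g y u v) *: u.
have gn : g y n n = 0.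
  rewrite /n !(bilinear_on_comb g_lin _ _ _ _ _ Ay).1.
  rewrite !(bilinear_on_comb g_lin _ _ _ _ _ Ay).2 (gC v u Ay).
  transitivity (g y u u * (g y u u * g y v v - g y u v * g y u v)); first by ring.
  by rewrite D0 mulr0.
have n0 : n = 0.
  by apply/eqP/negPn/negP => /(G_pos Ay); rewrite gn ltxx.
have := (bilinear_on_comb w_lin (g y u u) (- g y u v) v u u Ay).2.
rewrite -/n n0 (bilinear_on0 w_lin u Ay).2 w_diag// mulr0 addr0.
move=> /esym/eqP; rewrite mulf_eq0 => /orP[/eqP guu|/eqP //].
have -> : u = 0 by apply/eqP/negPn/negP => /(G_pos Ay); rewrite guu ltxx.
by rewrite (bilinear_on0 w_lin v Ay).1.
Qed.

Definition locally_dependent (U : set V) (X Y Z : V -> V) : Prop :=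
  exists q r a b c, [/\ U q, 0 < r, [|| a != 0, b != 0 | c != 0] &
    forall v, `|v| < r -> a *: X (q + v) + b *: Y (q + v) + c *: Z (q + v) = 0 :> V].

Let sub_invariant2 U X h : U `<=` A -> invariant2 A X h -> invariant2 U X h.
Proof. by move=> UA LX x b c Ux; apply: LX; exact: UA. Qed.

Let g_restrict B : B `<=` A -> [/\ bilinear_on B g,
  forall y u v, B y -> g y u v = g y v u &
  forall b c y, B y -> differentiable (fun y => g y b c) y].
Proof.
move=> BA; split.
- by split=> z c /BA; [exact: g_lin.1|exact: g_lin.2].
- by move=> z p p' /BA; exact: gC.
- by move=> p p' z /BA; exact: smooth_on_differentiable (g_smooth p p').
Qed.

Lemma locally_constant_comb (U : set V) X Y Z (l a b : V -> R) (q : V) :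
  open U -> U `<=` A -> U q ->
  chart_symmetry X -> chart_symmetry Y -> chart_symmetry Z ->
  commute_on A X Y -> commute_on A X Z -> commute_on A Y Z ->
  (forall y, A y -> differentiable l y) -> (forall y, A y -> differentiable a y) ->
  (forall y, A y -> differentiable b y) ->
  (forall y, A y -> l y != 0 -> w y (X y) (Y y) != 0) ->
  (forall y, U y -> l y *: Z y = a y *: X y + b y *: Y y) -> l q != 0 ->
  exists r s t, 0 < r /\ forall v, `|v| < r -> Z (q + v) = s *: X (q + v) + t *: Y (q + v).
Proof.
move=> oU UA Uq SX SY SZ cXY cXZ cYZ dl da db lw ZE lq.
pose B := [set y | U y /\ l y != 0].
have oB : open B by apply: open_neq0 => // y /UA; exact: dl.
have BA : B `<=` A by move=> y [/UA].
have dla (h : V -> R) : (forall y, A y -> differentiable h y) ->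
    forall y, B y -> differentiable (fun y => h y / l y) y.
  move=> dh y By; have Ay := BA _ By; apply: differentiableM; first exact: dh.
  by apply: differentiableV; [exact: dl|case: By].
have D y v : B y -> 'D_v (fun y => a y / l y) y = 0 /\ 'D_v (fun y => b y / l y) y = 0.
  move=> By; have Ay := BA _ By; case: (By) => Uy ly.
  have res h : invariant2 A h g -> invariant2 B h g := sub_invariant2 BA.
  have [gl gs gd] := g_restrict BA.
  apply: (@killing_comb_constant _ _ B oB g gl gs gd X Y Z) => //.
  - exact: smooth_on_differentiable (cs_smooth SX) Ay.
  - exact: smooth_on_differentiable (cs_smooth SY) Ay.
  - exact: dla.
  - exact: dla.
  - exact/res/cs_killing.
  - exact/res/cs_killing.
  - exact/res/cs_killing.
  - by move=> z /BA; exact: cXY.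
  - by move=> z /BA; exact: cXZ.
  - by move=> z /BA; exact: cYZ.
  - move=> z [Uz lz]; rewrite -[Z z](scalerK lz) ZE// scalerDr !scalerA.
    by rewrite ![(l z)^-1 * _]mulrC.
  - by apply: gram_neq0 => //; exact: lw.
have Bq : B q by split.
have [r1 r10 H1] := derive0_locally_constant oB Bq (dla a da) (fun y v By => (D y v By).1).
have [r2 r20 H2] := derive0_locally_constant oB Bq (dla b db) (fun y v By => (D y v By).2).
exists (Num.min r1 r2), (a q / l q), (b q / l q); split; first by rewrite lt_min r10.
move=> v; rewrite lt_min => /andP[/H1[[Uqv lqv] <-] /H2[_ <-]].
rewrite -[Z _](scalerK lqv) ZE// scalerDr !scalerA.
by rewrite ![(l _)^-1 * _]mulrC.
Qed.

Lemma locally_constant_scale (U : set V) X Y (q : V) :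
  open U -> U `<=` A -> U q -> chart_symmetry X -> chart_symmetry Y ->
  X q != 0 ->
  (forall y, U y -> X y != 0 -> exists a, Y y = a *: X y) ->
  exists r s, 0 < r /\ forall v, `|v| < r -> Y (q + v) = s *: X (q + v).
Proof.
move=> oU UA Uq SX SY Xq YE.
have dX y (Ay : A y) := smooth_on_differentiable (cs_smooth SX) Ay.
have dY y (Ay : A y) := smooth_on_differentiable (cs_smooth SY) Ay.
have dgXY (Z : V -> V) y : A y -> differentiable Z y ->
    differentiable (fun y => g y (X y) (Z y)) y.
  move=> Ay dZ.
  have dg b c : differentiable (fun y => g y b c) y.
    exact: smooth_on_differentiable (g_smooth b c) Ay.
  by have [] := derive_slot2 oA Ay g_lin.1 g_lin.2 dg (dX y Ay) dZ.
pose B := [set y | U y /\ g y (X y) (X y) != 0].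
have oB : open B by apply: open_neq0 => // y /UA Ay; exact/dgXY/dX.
have BA : B `<=` A by move=> y [/UA].
have Bq : B q by split=> //; rewrite gt_eqF// G_pos//; exact: UA.
pose a y := g y (X y) (Y y) / g y (X y) (X y).
have YaX y : B y -> Y y = a y *: X y.
  move=> [Uy gy]; have X0 : X y != 0.
    by apply: contraNneq gy => ->; rewrite (bilinear_on0 g_lin _ (UA _ Uy)).1.
  have [s E] := YE y Uy X0; rewrite /a E; congr (_ *: _).
  have := (bilinear_on_comb g_lin s 0 (X y) (X y) (X y) (UA _ Uy)).2.
  by rewrite scale0r addr0 mul0r addr0 => ->; rewrite mulfK.
have da y : B y -> differentiable a y.
  move=> By; have Ay := BA _ By; apply: differentiableM; first exact/dgXY/dY.
  by apply: differentiableV; [exact/dgXY/dX|case: By].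
have Da y v : B y -> 'D_v a y = 0.
  move=> By; have Ay := BA _ By.
  have [gl gs gd] := g_restrict BA.
  apply: (@killing_scale_constant _ _ B oB g gl gd X Y) => //.
  - exact: dX.
  - exact: da.
  - exact/(sub_invariant2 BA)/cs_killing.
  - exact/(sub_invariant2 BA)/cs_killing.
  - by case: By.
have [r r0 H] := derive0_locally_constant oB Bq da Da.
by exists r, (a q); split=> // v /H[By <-]; exact: YaX.
Qed.

(* d (psi^- (X, Y, Z)) = 2 (omega /\ omega) (X, Y, Z, .). *)
Lemma vanishing_psim_relation U X Y Z y : open U -> U `<=` A -> U y ->
  chart_symmetry X -> chart_symmetry Y -> chart_symmetry Z ->
  commute_on A X Y -> commute_on A X Z -> commute_on A Y Z ->
  (forall y, U y -> Q y (rows3 (X y) (Y y) (Z y)) = 0) ->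
  w y (X y) (Y y) *: Z y - w y (X y) (Z y) *: Y y + w y (Y y) (Z y) *: X y = 0.
Proof.
move=> oU UA Uy SX SY SZ cXY cXZ cYZ Q0; have Ay := UA _ Uy.
apply: (w_nondegenerate Ay) => v.
have alt12 z b c d : A z -> T' z b c d = - T' z c b d.
  by move=> Az; exact: (form3_antisym (Q_lin Az) (Q_alt Az) b c d).1.
have alt23 z b c d : A z -> T' z b c d = - T' z b d c.
  by move=> Az; exact: (form3_antisym (Q_lin Az) (Q_alt Az) b c d).2.
have := ext_d3_contraction oA T'_lin (fun b c d => Q_smooth (rows3 b c d))
  alt12 alt23 v Ay (cs_smooth SX) (cs_smooth SY) (cs_smooth SZ)
  (chart_symmetry_psim SX) (chart_symmetry_psim SY) (chart_symmetry_psim SZ) cXY cXZ cYZ.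
rewrite (eq_derive_in v oU Uy Q0) derive_cst oppr0 dQ// => E.
have wD u1 u2 : w y (u1 + u2) v = w y u1 v + w y u2 v.
  by rewrite /w mulmxDl -[u1 *m _]scale1r (bilin_scalar _).1 mul1r scale1r.
have wN u1 : w y (- u1) v = - w y u1 v by rewrite /w mulNmx bilinNl.
have wZ k u1 : w y (k *: u1) v = k * w y u1 v.
  by rewrite -[k *: u1]addr0 w_lin.1// (bilinear_on0 w_lin v Ay).1 addr0.
rewrite !wD wN !wZ; move: E; lra.
Qed.

Lemma chart_dependent U X Y Z q : open U -> U `<=` A -> U q ->
  chart_symmetry X -> chart_symmetry Y -> chart_symmetry Z ->
  commute_on A X Y -> commute_on A X Z -> commute_on A Y Z ->
  (forall y, U y -> Q y (rows3 (X y) (Y y) (Z y)) = 0) ->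
  locally_dependent U X Y Z.
Proof.
move=> oU UA Uq SX SY SZ cXY cXZ cYZ Q0.
have dw' B C y : chart_symmetry B -> chart_symmetry C -> A y ->
    differentiable (fun y => w y (B y) (C y)) y.
  move=> SB SC Ay.
  exact: (derive_contraction oA w_lin w_smooth 0 Ay (cs_smooth SB) (cs_smooth SC)).1.
have dwN B C y : chart_symmetry B -> chart_symmetry C -> A y ->
    differentiable (fun y => - w y (B y) (C y)) y.
  by move=> SB SC Ay; apply: differentiableN; exact: dw'.
have rel y (Uy : U y) := vanishing_psim_relation oU UA Uy SX SY SZ cXY cXZ cYZ Q0.
have cC B C : commute_on A B C -> commute_on A C B by move=> h y Ay; rewrite h.
have [[y [Uy m]]|XY0] := pselect (exists y, U y /\ w y (X y) (Y y) != 0).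
  have E z : U z -> w z (X z) (Y z) *: Z z =
      - w z (Y z) (Z z) *: X z + w z (X z) (Z z) *: Y z.
    move=> /rel /eqP; rewrite addr_eq0 subr_eq => /eqP ->.
    by rewrite scaleNr addrC.
  have [r [s [t [r0 H]]]] := locally_constant_comb oU UA Uy SX SY SZ cXY cXZ cYZ
    (fun z => dw' _ _ z SX SY) (fun z => dwN _ _ z SY SZ)
    (fun z => dw' _ _ z SX SZ) (fun _ _ => id) E m.
  exists y, r, s, t, (-1); split=> // [|v /H ->]; first by rewrite oppr_eq0 oner_eq0 !orbT.
  by rewrite scaleN1r subrr.
have [[y [Uy m]]|XZ0] := pselect (exists y, U y /\ w y (X y) (Z y) != 0).
  have E z : U z -> w z (X z) (Z z) *: Y z =
      w z (Y z) (Z z) *: X z + w z (X z) (Y z) *: Z z.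
    by move=> /rel /eqP; rewrite addrAC subr_eq0 addrC => /eqP ->.
  have [r [s [t [r0 H]]]] := locally_constant_comb oU UA Uy SX SZ SY cXZ cXY (cC _ _ cYZ)
    (fun z => dw' _ _ z SX SZ) (fun z => dw' _ _ z SY SZ)
    (fun z => dw' _ _ z SX SY) (fun _ _ => id) E m.
  exists y, r, s, (-1), t; split=> // [|v /H ->]; first by rewrite oppr_eq0 oner_eq0 !orbT.
  by rewrite scaleN1r addrAC subrr.
have [[y [Uy m]]|YZ0] := pselect (exists y, U y /\ w y (Y y) (Z y) != 0).
  have E z : U z -> w z (Y z) (Z z) *: X z =
      w z (X z) (Z z) *: Y z + - w z (X z) (Y z) *: Z z.
    move=> /rel /eqP; rewrite addrC addr_eq0 => /eqP ->.
    by rewrite opprB scaleNr.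
  have [r [s [t [r0 H]]]] := locally_constant_comb oU UA Uy SY SZ SX cYZ (cC _ _ cXY) (cC _ _ cXZ)
    (fun z => dw' _ _ z SY SZ) (fun z => dw' _ _ z SX SZ)
    (fun z => dwN _ _ z SX SY) (fun _ _ => id) E m.
  exists y, r, (-1), s, t; split=> // [|v /H ->]; first by rewrite oppr_eq0 oner_eq0.
  by rewrite scaleN1r -addrA addNr.
have {}XY0 y : U y -> w y (X y) (Y y) = 0.
  by move=> Uy; apply/eqP/negPn/negP => m; apply: XY0; exists y.
have [[y [Uy Xy]]|X0] := pselect (exists y, U y /\ X y != 0); last first.
  have [r r0 H] := open_ball_sub oU Uq.
  exists q, r, 1, 0, 0; split=> // [|v /H Uqv]; first by rewrite oner_eq0.
  rewrite !scale0r scale1r !addr0.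
  by apply/eqP/negPn/negP => m; apply: X0; exists (q + v).
have YE z : U z -> X z != 0 -> exists a, Y z = a *: X z.
  move=> Uz Xz; have Az := UA _ Uz.
  have PXY v : P z (rows3 (X z) (Y z) v) = 0.
    have := ext_d2_contraction oA w_lin w_smooth w_alt v Az (cs_smooth SX) (cs_smooth SY)
      (chart_symmetry_omega SX) (chart_symmetry_omega SY) cXY.
    rewrite (eq_derive_in v oU Uz XY0) derive_cst dw// => /eqP.
    by rewrite mulf_eq0 pnatr_eq0 /= => /eqP.
  have [a [b YE]] := type30_degenerate (JJ Az) (P_lin Az) (P_alt Az) (Q_lin Az)
    (Q_alt Az) (fun v w' i => @PQ_type30 z v w' i Az) (vol_neq0 Az)
    (fun M' => PQ_norm M' Az) Xz PXY.
  exists a; have := XY0 z Uz; rewrite YE (bilinear_on_comb w_lin _ _ _ _ _ Az).2.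
  have -> : w z (X z) (X z *m J z) = g z (X z) (X z) by exact: J_orth.
  rewrite w_diag// mulr0 add0r => /eqP; rewrite mulf_eq0 => /orP[/eqP ->|].
    by rewrite scale0r addr0.
  by rewrite gt_eqF// G_pos.
have [r [s [r0 H]]] := locally_constant_scale oU UA Uy SX SY Xy YE.
exists y, r, s, (-1), 0; split=> // [|v /H ->]; first by rewrite oppr_eq0 oner_eq0 orbT.
by rewrite scaleN1r scale0r addr0 subrr.
Qed.

End NearlyKaehlerChart.

(** * Fields on manifolds *)

Section ChartTopology.
Context {R : realType} {n : nat}.
Variable M : manifold R n.
Implicit Types (c : chart M) (p : M).

Lemma open_chart_img c : open (chart_img c).
Proof. exact: chart_img_open. Qed.

Lemma chart_img_map c p : chart_dom c p -> chart_img c (chart_map c p).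
Proof. by exists p. Qed.

Lemma chart_invK c x : chart_img c x ->
  chart_dom c (chart_inv c x) /\ chart_map c (chart_inv c x) = x.
Proof. by move=> [p pd <-]; rewrite chart_mapK. Qed.

Lemma nbhs_chart_map c p (W : set 'rV[R]_n) : chart_dom c p ->
  nbhs (chart_map c p) W -> nbhs p [set p' | chart_dom c p' /\ W (chart_map c p')].
Proof.
move=> pd Wp; apply: filterI; first exact: open_nbhs_nbhs (conj (chart_dom_open c) pd).
have := @chart_map_continuous _ _ M c.
rewrite continuous_open_subspace; last exact: chart_dom_open.
by move=> /(_ p); rewrite inE => /(_ pd); apply.
Qed.

Lemma nbhs_chart_inv c x (O : set M) : chart_img c x -> nbhs (chart_inv c x) O ->
  nbhs x [set y | chart_img c y /\ O (chart_inv c y)].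
Proof.
move=> xi Ox; apply: filterI; first exact: open_nbhs_nbhs (conj (@open_chart_img c) xi).
have := @chart_inv_continuous _ _ M c.
rewrite continuous_open_subspace; last exact: chart_img_open.
by move=> /(_ x); rewrite inE => /(_ xi); apply.
Qed.

Lemma overlap_map c c' p : chart_dom c p -> chart_dom c' p -> overlap c c' (chart_map c p).
Proof. by move=> pd pd'; exists p. Qed.

Lemma vf_change_chart (X : vector_field M) c c' p : chart_dom c p -> chart_dom c' p ->
  X c' (chart_map c' p) =
  X c (chart_map c p) *m 'J (transition c c') (chart_map c p).
Proof.
move=> pd pd'; rewrite -(vf_transform X (overlap_map pd pd')).
by rewrite /transition /= chart_mapK.
Qed.

Definition zero_locus (X : vector_field M) : set M :=
  [set p | forall c, chart_dom c p -> X c (chart_map c p) = 0].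

Lemma zero_locus_chart (X : vector_field M) c p :
  chart_dom c p -> X c (chart_map c p) = 0 -> zero_locus X p.
Proof. by move=> pd X0 c' pd'; rewrite (vf_change_chart X pd pd') X0 mul0mx. Qed.

End ChartTopology.
Arguments open_chart_img {R n M} c.

Section KillingFields.
Context {R : realType} {n : nat}.
Variables (M : manifold R n) (g : riemannian_metric M).

Lemma killing_invariant2 (X : vector_field M) : killing g X <->
  forall c, invariant2 (chart_img c) (X c) (fun y u v => bilin (g c y) u v).
Proof.
have E c' u x : lie_bracket (X c') (cst u) x = - 'D_u (X c') x.
  by rewrite /lie_bracket derive_cst sub0r.
split=> [K c' x b d xi|K c' x u v xi].
  by have := K c' x b d xi; rewrite /lie_bilin !E bilinNl bilinNr !opprK.
by rewrite /lie_bilin !E bilinNl bilinNr !opprK; exact: K.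
Qed.

Lemma killing_unique_continuation (X : vector_field M) c0 x0 (r : R) :
  connected [set: M] -> killing g X -> chart_img c0 x0 -> 0 < r ->
  (forall v, `|v| < r -> X c0 (x0 + v) = 0) ->
  forall c x, chart_img c x -> X c x = 0.
Proof.
move=> Mconn /killing_invariant2 K xi0 r0 X0.
pose B := (zero_locus X)^°.
have BT : B = [set: M].
  apply: Mconn.
  - have [p0d p0x] := chart_invK xi0.
    exists (chart_inv c0 x0).
    have := nbhs_chart_map p0d (W := ball x0 r); rewrite p0x => /(_ (nbhsx_ballx _ _ r0)).
    apply: filterS => p' [p'd]; rewrite -ball_normE /ball_ /= => xp'.
    apply: (zero_locus_chart p'd); rewrite -(subrKC x0 (chart_map c0 p')) X0//.
    by rewrite distrC.
  - by exists B; [exact: open_interior|rewrite setTI].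
  - exists B; last by rewrite setTI.
    move=> p clp; have [c pd] := chart_cover p.
    pose x := chart_map c p; have xi : chart_img c x := chart_img_map pd.
    have [s s0 Hs] := open_ball_sub (open_chart_img c) xi.
    have nN := nbhs_chart_map pd (W := ball x s) (nbhsx_ballx _ _ s0).
    have [p' [Bp' [p'd]]] := clp _ nN; rewrite -ball_normE /ball_ /= => xp'.
    pose y0 := chart_map c p'; have y0i : chart_img c y0 := chart_img_map p'd.
    have near0 : \forall y \near y0, X c y = 0.
      have Bp'' : nbhs (chart_inv c y0) (zero_locus X) by rewrite chart_mapK.
      apply: filterS (nbhs_chart_inv y0i Bp'') => y [yi].
      by have [yd yE] := chart_invK yi => /(_ c yd); rewrite yE.
    have D0 b : 'D_b (X c) y0 = 0.
      rewrite (near_eq_derive (g := cst 0) b); first exact: derive_cst.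
      exact: near0.
    apply: filterS nN => p1 [p1d]; rewrite -ball_normE /ball_ /= => xp1.
    apply: (zero_locus_chart p1d); rewrite -(subrKC y0 (chart_map c p1)).
    apply: (killing_eq0_segment (open_chart_img c) (G := g c)) => //.
    + by move=> i j; exact/(smooth_on_entry (open_chart_img c))/gram_smooth.
    + by move=> y; exact: gram_sym.
    + by move=> y yi; apply: posdef_unitmx => v; exact: gram_pos.
    + exact: vf_smooth.
    + move=> t /andP[t0 t1].
      have -> : y0 + t *: (chart_map c p1 - y0) =
          x + ((1 - t) *: (y0 - x) + t *: (chart_map c p1 - x)).
        by apply/rowP => i; rewrite !mxE; ring.
      apply: Hs; apply: le_lt_trans (ler_normD _ _) _.
      pose m := Num.max `|y0 - x| `|chart_map c p1 - x|.
      apply: (@le_lt_trans _ _ ((1 - t) * m + t * m)); last first.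
        by rewrite -mulrDl subrK mul1r /m gt_max distrC xp' distrC.
      rewrite !normrZ !ger0_norm ?subr_ge0// lerD// ler_wpM2l ?subr_ge0//.
        by rewrite /m le_max lexx.
      by rewrite /m le_max lexx orbT.
    + exact: nbhs_singleton near0.
move=> c x xi; have [xd xE] := chart_invK xi.
have : B (chart_inv c x) by rewrite BT.
by move=> /nbhs_singleton/(_ c xd); rewrite xE.
Qed.


Lemma vf_comb_smooth d (a : 'I_d -> R) (X : 'I_d -> vector_field M) c :
  smooth_on (chart_img c) (fun x => \sum_l a l *: X l c x).
Proof.
apply: smooth_on_sum => [|l _]; first exact: open_chart_img.
by apply: smooth_onZ; [exact: open_chart_img|exact: vf_smooth].
Qed.

Lemma vf_comb_transform d (a : 'I_d -> R) (X : 'I_d -> vector_field M) c c' x :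
  overlap c c' x -> \sum_l a l *: X l c' (transition c c' x) =
  (\sum_l a l *: X l c x) *m 'J (transition c c') x.
Proof.
move=> xo; rewrite mulmx_suml; apply: eq_bigr => l _.
by rewrite -scalemxAl vf_transform.
Qed.

Definition vf_comb d (a : 'I_d -> R) (X : 'I_d -> vector_field M) : vector_field M :=
  @VectorField R n M (fun c x => \sum_l a l *: X l c x)
    (vf_comb_smooth a X) (@vf_comb_transform d a X).

Lemma killing_comb d (a : 'I_d -> R) (X : 'I_d -> vector_field M) :
  (forall l, killing g (X l)) -> killing g (vf_comb a X).
Proof.
move=> K; apply/killing_invariant2 => c x u v xi /=.
have KX l := (killing_invariant2 (X l)).1 (K l) c x u v xi.
have dX l : differentiable (X l c) x.
  exact: smooth_on_differentiable (@vf_smooth _ _ _ (X l) c) xi.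
have dg : differentiable (fun y => bilin (g c y) u v) x.
  apply: smooth_on_differentiable xi; apply: smooth_on_bilin; first exact: open_chart_img.
  by move=> i j; exact/(smooth_on_entry (open_chart_img c))/gram_smooth.
have DE p : 'D_p (fun y => \sum_l a l *: X l c y) x = \sum_l a l *: 'D_p (X l c) x.
  have -> : (fun y => \sum_l a l *: X l c y) = \sum_(l < d) (a l \*: X l c).
    by apply/funext => y; rewrite fct_sumE.
  rewrite derive_sum => [|l]; last exact/derivableZ/diff_derivable.
  by apply: eq_bigr => l _; rewrite deriveZ//; exact: diff_derivable.
rewrite !DE [X in X + _ + _]deriveE// linear_sum /=.
have lin1 (f : 'I_d -> 'rV[R]_n) :
    bilin (g c x) (\sum_l f l) v = \sum_l bilin (g c x) (f l) v.
  by rewrite /bilin !mulmx_suml summxE.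
have lin2 (f : 'I_d -> 'rV[R]_n) :
    bilin (g c x) u (\sum_l f l) = \sum_l bilin (g c x) u (f l).
  by rewrite /bilin linear_sum mulmx_sumr summxE.
rewrite lin1 lin2 -!big_split big1// => l _ /=.
rewrite linearZ /= -deriveE//.
rewrite bilinZl bilinZr -[X in X + _ + _]/(a l * _) -!mulrDr.
by have -> := KX l; rewrite mulr0.
Qed.

End KillingFields.

Section NearlyKaehler.
Context {R : realType}.
Variables (M : manifold R 6) (S : SU3_structure M).
Hypothesis SNK : strict_nearly_kahler S.
Notation V := 'rV[R]_6.
Implicit Types (c : chart M) (x y : V).

Let w c y (a b : V) := bilin (metric S c y) (a *m acs S c y) b.

Definition rows4 (a b c d : V) : 'M[R]_(4, 6) := \matrix_(i < 4) [:: a; b; c; d]`_i.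

Lemma row'_rows3_2 (a b d : V) (i : 'I_3) :
  row 0 (row' i (rows3 a b d)) = [:: b; a; a]`_i /\
  row 1 (row' i (rows3 a b d)) = [:: d; d; b]`_i.
Proof.
by split; apply/rowP => k; rewrite !mxE; case: i => [[|[|[|//]]] i3].
Qed.

Lemma row'_rows4 (a b d e : V) (i : 'I_4) :
  row' i (rows4 a b d e) =
  [:: rows3 b d e; rows3 a d e; rows3 a b e; rows3 a b d]`_i.
Proof.
apply/matrixP => j k; rewrite mxE.
by case: i => [[|[|[|[|//]]]] i3] /=; rewrite !mxE; case: j => [[|[|[|//]]] j3].
Qed.

Let alt_sum3 (D : nat -> R) : \sum_(i < 3) (-1) ^+ i * D i = D 0%N - D 1%N + D 2%N.
Proof. by rewrite !big_ord_recl big_ord0 /=; ring. Qed.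

Let alt_sum4 (D : nat -> R) :
  \sum_(i < 4) (-1) ^+ i * D i = D 0%N - D 1%N + D 2%N - D 3%N.
Proof. by rewrite !big_ord_recl big_ord0 /=; ring. Qed.

Lemma ext_d2_omega c y a b d : chart_img c y ->
  ext_d2 (w c) y a b d = 3 * psip S c y (rows3 a b d).
Proof.
move=> yi; apply: etrans (SNK.1 c y (rows3 a b d) yi).
pose D i := 'D_([:: a; b; d]`_i) (fun z => w c z [:: b; a; a]`_i [:: d; d; b]`_i) y.
have E : ext_d2 (w c) y a b d = D 0%N - D 1%N + D 2%N by [].
apply: etrans E _; apply: etrans (esym (alt_sum3 D)) _.
apply: eq_bigr => i _.
have Ef : (fun z => omega S c z (row' i (rows3 a b d))) =
    (fun z => w c z [:: b; a; a]`_i [:: d; d; b]`_i).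
  apply/funext => z; rewrite /omega /fund_form /w.
  by have [-> ->] := row'_rows3_2 a b d i.
exact: esym (congr1 (fun t : R => (-1) ^+ i * t)
  (f_equal2 (fun (f : V -> R) u => 'D_u f y) Ef (rowK (nth 0 [:: a; b; d]) i))).
Qed.

Lemma omega_antisym c y a b : chart_img c y -> w c y a b = - w c y b a.
Proof.
move=> yi; rewrite /w -(@acs_compatible _ _ S _ _ _ _ yi) -mulmxA acs_sq// mulmxN mulmx1.
by rewrite bilinNl (bilinC _ _ (@gram_sym _ _ _ _ _ _ yi)).
Qed.

Lemma ext_d3_psim c y a b d e : chart_img c y ->
  ext_d3 (fun y a b d => psim S c y (rows3 a b d)) y a b d e =
  - 2 * (2 * (w c y a b * w c y d e - w c y a d * w c y b e + w c y a e * w c y b d)).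
Proof.
move=> yi.
have <- : wedge (omega S c y) (omega S c y) (rows4 a b d e : 'M[R]_(2 + 2, 6)) =
    2 * (w c y a b * w c y d e - w c y a d * w c y b e + w c y a e * w c y b d).
  apply: (wedge_two_forms (h := w c y) (r := fun i => [:: a; b; d; e]`_i)) => //.
    by move=> u v; exact: omega_antisym.
  by move=> i; rewrite rowK.
apply: etrans (SNK.2 c y (rows4 a b d e) yi).
pose D i := 'D_([:: a; b; d; e]`_i) (fun z => psim S c z
  [:: rows3 b d e; rows3 a d e; rows3 a b e; rows3 a b d]`_i) y.
have E : ext_d3 (fun y a b d => psim S c y (rows3 a b d)) y a b d e =
  D 0%N - D 1%N + D 2%N - D 3%N by [].
apply: etrans E _; apply: etrans (esym (alt_sum4 D)) _.
apply: eq_bigr => i _.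
have Ef : (fun z => psim S c z (row' i (rows4 a b d e))) = (fun z => psim S c z
    [:: rows3 b d e; rows3 a d e; rows3 a b e; rows3 a b d]`_i).
  by apply/funext => z; rewrite row'_rows4.
exact: esym (congr1 (fun t : R => (-1) ^+ i * t)
  (f_equal2 (fun (f : V -> R) u => 'D_u f y) Ef (rowK (nth 0 [:: a; b; d; e]) i))).
Qed.

Lemma nk_chart_symmetry (X : vector_field M) c :
  killing (metric S) X -> preserves_endo (acs S) X ->
  chart_symmetry (chart_img c) (metric S c) (acs S c) (X c).
Proof.
move=> /killing_invariant2 KX JX; split.
- exact: vf_smooth.
- exact: KX.
- move=> y b yi; have := JX c y b yi; rewrite /lie_endo /lie_bracket derive_cst sub0r.
  by rewrite mulNmx opprK -addrA => /eqP; rewrite addr_eq0 => /eqP ->; rewrite opprD opprK.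
Qed.

Lemma nk_commute (X Y : vector_field M) c : commuting X Y ->
  commute_on (chart_img c) (X c) (Y c).
Proof. by move=> XY y yi; apply/eqP; rewrite -subr_eq0; apply/eqP; exact: XY. Qed.

Lemma nk_chart_dependent (X Y Z : vector_field M) c (U : set V) q :
  open U -> U `<=` chart_img c -> U q ->
  killing (metric S) X -> killing (metric S) Y -> killing (metric S) Z ->
  preserves_endo (acs S) X -> preserves_endo (acs S) Y -> preserves_endo (acs S) Z ->
  commuting X Y -> commuting X Z -> commuting Y Z ->
  (forall y, U y -> psim S c y (rows3 (X c y) (Y c y) (Z c y)) = 0) ->
  locally_dependent U (X c) (Y c) (Z c).
Proof.
move=> oU UA Uq KX KY KZ JX JY JZ XY XZ YZ Q0.
have oA := open_chart_img c.
apply: (@chart_dependent R (chart_img c) (metric S c) (acs S c) (psip S c) (psim S c)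
  (fun y => Num.sqrt (\det (metric S c y))) oA) Uq _ _ _ _ _ _ Q0 => //.
all: try exact: nk_chart_symmetry.
all: try exact: nk_commute.
- by move=> i j; exact/(smooth_on_entry oA)/gram_smooth.
- by move=> y; exact: gram_sym.
- by move=> y v yi; exact: gram_pos.
- by move=> i j; exact/(smooth_on_entry oA)/ef_smooth.
- by move=> y; exact: acs_sq.
- by move=> y u v; exact: acs_compatible.
- by move=> y; exact: df_multilinear.
- by move=> y; exact: df_alternating.
- by move=> y; exact: df_multilinear.
- by move=> y; exact: df_alternating.
- by move=> u; exact: df_smooth.
- by move=> u; exact: df_smooth.
- by move=> y v v' a yi; exact: psi_type30.
- by move=> y N yi; exact: psi_norm.
- move=> y yi; rewrite sqrtr_eq0 -ltNge; apply: posdef_det_gt0 => v.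
  exact: gram_pos.
- by move=> y a b d; exact: ext_d2_omega.
- by move=> y a b d e; exact: ext_d3_psim.
Qed.

End NearlyKaehler.

Lemma rows3_mulmx (R : realType) n (a b c : 'rV[R]_n) (B : 'M[R]_n) :
  rows3 a b c *m B = rows3 (a *m B) (b *m B) (c *m B).
Proof.
apply/row_matrixP => i; rewrite row_mul !rowK.
by case: i => [[|[|[|//]]] i3].
Qed.

Section Independence.
Context {R : realType}.
Variables (M : manifold R 6) (S : SU3_structure M).
Variables X Y Z : vector_field M.

Definition psim_locus : set M := [set p | exists2 c, chart_dom c p &
  psim S c (chart_map c p)
    (rows3 (X c (chart_map c p)) (Y c (chart_map c p)) (Z c (chart_map c p))) != 0].

Lemma psim_locusP p c : psim_locus p -> chart_dom c p ->
  psim S c (chart_map c p)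
    (rows3 (X c (chart_map c p)) (Y c (chart_map c p)) (Z c (chart_map c p))) != 0.
Proof.
move=> [c' pd' Q0] pd; apply: contra Q0 => /eqP Q0; apply/eqP; rewrite -Q0.
rewrite (df_transform _ _ (overlap_map pd pd')) rows3_mulmx -!vf_change_chart//.
by rewrite /transition /= chart_mapK.
Qed.

Lemma open_psim_locus : open psim_locus.
Proof.
rewrite openE => p [c pd Q0].
have oA := open_chart_img c.
pose h y := psim S c y (rows3 (X c y) (Y c y) (Z c y)).
have dh y : chart_img c y -> differentiable h y.
  move=> yi.
  have dV (W : vector_field M) : differentiable (W c) y.
    by apply: smooth_on_differentiable yi; exact: vf_smooth.
  have lin z (zi : chart_img c z) := form3_scalar (df_multilinear (psim S) zi).
  have dQ a b d : differentiable (fun z => psim S c z (rows3 a b d)) y.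
    by apply: smooth_on_differentiable yi; exact: df_smooth.
  have [] // := @derive_slot3 R 6 (chart_img c) y oA yi
    (fun z a b d => psim S c z (rows3 a b d)) (X c) (Y c) (Z c) _ _ _ dQ (dV X) (dV Y) (dV Z).
  - by move=> z b d /lin[].
  - by move=> z a d /lin[].
  - by move=> z a b /lin[].
have oB := open_neq0 oA dh.
have := nbhs_chart_map pd (open_nbhs_nbhs (conj oB (conj (chart_img_map pd) Q0))).
by apply: filterS => p' [p'd [_ hp']]; exists c.
Qed.

Hypothesis SNK : strict_nearly_kahler S.

Lemma psim_locus_dense :
  killing (metric S) X -> killing (metric S) Y -> killing (metric S) Z ->
  preserves_endo (acs S) X -> preserves_endo (acs S) Y -> preserves_endo (acs S) Z ->
  commuting X Y -> commuting X Z -> commuting Y Z ->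
  (forall (a b e : R), [|| a != 0, b != 0 | e != 0] -> forall c q r,
     chart_img c q -> 0 < r ->
     ~ forall v, `|v| < r -> a *: X c (q + v) + b *: Y c (q + v) + e *: Z c (q + v) = 0) ->
  dense psim_locus.
Proof.
move=> KX KY KZ JX JY JZ XY XZ YZ indep O [p Op] oO.
apply: contrapT => noO.
have [c pd] := chart_cover p.
pose U : set 'rV[R]_6 := [set y | chart_img c y /\ O (chart_inv c y)].
have UA : U `<=` chart_img c by move=> y [].
have oU : open U.
  rewrite openE => y [yi Oy].
  exact: (nbhs_chart_inv yi (open_nbhs_nbhs (conj oO Oy))).
have Up : U (chart_map c p) by split; [exact: chart_img_map|rewrite chart_mapK].
have Q0 y : U y -> psim S c y (rows3 (X c y) (Y c y) (Z c y)) = 0.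
  move=> [yi Oy]; apply/eqP/negPn/negP => Qy; apply: noO.
  have [yd yE] := chart_invK yi.
  by exists (chart_inv c y); split=> //; exists c => //; rewrite yE.
have [q [r [a [b [e [Uq r0 abe H]]]]]] :=
  nk_chart_dependent SNK oU UA Up KX KY KZ JX JY JZ XY XZ YZ Q0.
exact: (indep a b e abe c q r (UA _ Uq) r0 H).
Qed.

End Independence.

Theorem lemma3p4 (R : realType) (M : manifold R 6)
    (Mconn : connected [set: M])
    (S : SU3_structure M) (SNK : strict_nearly_kahler S)
    (d : nat) (d_ge3 : (3 <= d)%N)
    (zeta : 'I_d -> vector_field M)
    (zeta_indep : lin_indep_fields zeta)
    (zeta_comm : forall i j : 'I_d, commuting (zeta i) (zeta j))
    (zeta_killing : forall i : 'I_d, killing (metric S) (zeta i))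
    (zeta_J : forall i : 'I_d, preserves_endo (acs S) (zeta i)) :
  forall i j k : 'I_d, i != j -> i != k -> j != k ->
  exists M0 : set M,
    [/\ open M0, dense M0 &
     forall (p : M) (c : chart M), M0 p -> chart_dom c p ->
       let x := chart_map c p in
       free [:: zeta i c x; zeta j c x; zeta k c x;
                zeta i c x *m acs S c x;
                zeta j c x *m acs S c x;
                zeta k c x *m acs S c x]].
Proof.
move=> i j k ij ik jk; exists (psim_locus S (zeta i) (zeta j) (zeta k)); split.
- exact: open_psim_locus.
- apply: psim_locus_dense => //.
  move=> a b e abe c q r qi r0 H.
  pose coef l := if l == i then a else if l == j then b else if l == k then e else 0.
  have ci : coef i = a by rewrite /coef eqxx.
  have cj : coef j = b by rewrite /coef [j == i]eq_sym (negbTE ij) eqxx.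
  have ck : coef k = e.
    by rewrite /coef [k == i]eq_sym [k == j]eq_sym (negbTE ik) (negbTE jk) eqxx.
  have combE c' y : \sum_l coef l *: zeta l c' y =
      a *: zeta i c' y + b *: zeta j c' y + e *: zeta k c' y.
    rewrite (bigD1 i)//= (bigD1 j)/=; last by rewrite eq_sym.
    rewrite (bigD1 k)/=; last by rewrite [k == i]eq_sym [k == j]eq_sym ik jk.
    rewrite ci cj ck big1 ?addr0 ?addrA//.
    move=> l /andP[/andP[li lj] lk]; rewrite /coef (negbTE li) (negbTE lj) (negbTE lk).
    by rewrite scale0r.
  have comb0 c' y : chart_img c' y -> vf_comb coef zeta c' y = 0.
    apply: (killing_unique_continuation Mconn (killing_comb coef zeta_killing) qi r0).
    by move=> v /H; rewrite -combE.
  have coef0 := zeta_indep coef comb0.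
  move: abe; have := coef0 i; have := coef0 j; have := coef0 k.
  by rewrite ci cj ck => -> -> ->; rewrite eqxx.
- move=> p c pM pd /=; have xi := chart_img_map pd.
  apply: (type30_free (P := psip S c (chart_map c p)) (Q := psim S c (chart_map c p))).
  + exact: df_multilinear.
  + exact: df_alternating.
  + exact: df_multilinear.
  + exact: df_alternating.
  + by move=> v w a; exact: psi_type30.
  + exact: psim_locusP pM pd.
Qed.
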